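(* The limits $c_1=\lim_{k\to\infty}f_1(k)$ and $c_2=\lim_{k\to\infty}\min\{f_1(k),f_2(k)\}$ exist.
   Context: For a bounded region $Q\subset\mathbb{R}^2$ and a positive integer $k$, let $\mathcal{P}_Q$ be a Poisson process of intensity one in $Q$, and let $G_{Q,k}$ be the undirected graph on $\mathcal{P}_Q$ in which $x,y$ are adjacent if $y$ is one of the $k$ nearest neighbours of $x$ (among points of $\mathcal{P}_Q$) or vice versa. Let $S_n$ be a square of area $n$ and $G_{n,k}=G_{S_n,k}$. Let $M$ be a fixed real constant with $M\ge 40$ such that, whenever $0.30\log n<k<0.52\log n$, the probability that $G_{n,k}$ contains two components each of Euclidean diameter greater than $\frac18 M\sqrt{k}$ is $o(e^{-9k})$ as $k\to\infty$. Let $S=[-\frac12M\sqrt k,\frac12M\sqrt k]^2$ and $S'=\frac12 S$; $A_k$ is the event that $G_{S,k}$ has a connected component all of whose vertices lie in $S'$. Let $R=[0,M\sqrt k]\times[-\frac12M\sqrt k,\frac12M\sqrt k]$ and $R'=\frac12R$; $B_k$ is the event that $G_{R,k}$ has a connected component all of whose vertices lie in $R'$. Put $p_1(k)=\Pr(A_k)$, $p_2(k)=\Pr(B_k)$, $f_1(k)=-\log p_1(k)/k$, $f_2(k)=-\log p_2(k)/k$. *)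

(* Defs.v *)
From HB Require Import structures.
From mathcomp Require Import all_boot all_order all_algebra.
From mathcomp Require Import all_classical all_reals all_analysis.
Unset Printing Implicit Defensive.
Import Order.TTheory GRing.Theory Num.Theory.
Import numFieldNormedType.Exports.
Local Open Scope classical_set_scope.
Local Open Scope ring_scope.

Section KNN.
Variable R : realType.

Definition pt := (R * R)%type.

Definition d2 (p q : pt) : R := (p.1 - q.1) ^+ 2 + (p.2 - q.2) ^+ 2.
Definition edist (p q : pt) : R := Num.sqrt (d2 p q).

Definition vtx (s : seq pt) (i : 'I_(size s)) : pt := nth (0, 0) s i.

(* j is one of the k nearest neighbours of i: j <> i and fewer than k other
   points are strictly closer to i than j is (ties have probability 0). *)
Definition knn (s : seq pt) (k : nat) (i j : 'I_(size s)) : bool :=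
  (j != i) &&
  (#|[set l : 'I_(size s) | (l != i) &&
        (d2 (vtx s l) (vtx s i) < d2 (vtx s j) (vtx s i))%R]| < k)%N.

Definition knn_adj (s : seq pt) (k : nat) : rel 'I_(size s) :=
  fun i j => knn s k i j || knn s k j i.

Definition has_comp_inside (k : nat) (Q' : set pt) (s : seq pt) : Prop :=
  exists i : 'I_(size s),
    forall j : 'I_(size s), connect (knn_adj s k) i j -> Q' (vtx s j).

Definition comp_diam_gt (k : nat) (D : R) (s : seq pt) (i : 'I_(size s)) : Prop :=
  exists a b : 'I_(size s),
    [/\ connect (knn_adj s k) i a, connect (knn_adj s k) i b &
        D < edist (vtx s a) (vtx s b)].

Definition two_big_comps (k : nat) (D : R) (s : seq pt) : Prop :=
  exists i1 i2 : 'I_(size s),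
    [/\ ~~ connect (knn_adj s k) i1 i2, comp_diam_gt k D s i1 &
        comp_diam_gt k D s i2].

Fixpoint mint (Q : set pt) (m : nat) (f : seq pt -> \bar R) : \bar R :=
  match m with
  | 0 => f [::]
  | m'.+1 =>
    (\int[@lebesgue_measure R]_x \int[@lebesgue_measure R]_y
        ((\1_Q (x, y))%:E * mint Q m' (fun t => f ((x, y) :: t))))%E
  end.

Definition area (Q : set pt) : \bar R := mint Q 1 (fun _ => 1%E).

(* Probability that the Poisson process of intensity one in the bounded
   region Q has property E: N ~ Poisson(|Q|) points, i.i.d. uniform in Q
     Pr(E) = sum_m e^{-|Q|} |Q|^m/m! * |Q|^{-m} int_{Q^m} 1_E . *)
Definition PPprob (Q : set pt) (E : seq pt -> Prop) : R :=
  fine (\sum_(m <oo)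
          ((expR (- fine (area Q)) / (m`!)%:R)%:E
             * mint Q m (fun s => (\1_E s)%:E)))%E.

Definition Sn (n : nat) : set pt :=
  [set p | 0 <= p.1 <= Num.sqrt n%:R /\ 0 <= p.2 <= Num.sqrt n%:R].

Definition hs (M : R) (k : nat) : R := M * Num.sqrt k%:R / 2.

Definition Ssq (M : R) (k : nat) : set pt :=
  [set p | `|p.1| <= hs M k /\ `|p.2| <= hs M k].
Definition Ssq' (M : R) (k : nat) : set pt :=
  [set p | `|p.1| <= hs M k / 2 /\ `|p.2| <= hs M k / 2].

Definition Rrect (M : R) (k : nat) : set pt :=
  [set p | 0 <= p.1 <= 2 * hs M k /\ `|p.2| <= hs M k].
Definition Rrect' (M : R) (k : nat) : set pt :=
  [set p | 0 <= p.1 <= hs M k /\ `|p.2| <= hs M k / 2].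

Definition p1 (M : R) (k : nat) : R := PPprob (Ssq M k) (has_comp_inside k (Ssq' M k)).
Definition p2 (M : R) (k : nat) : R := PPprob (Rrect M k) (has_comp_inside k (Rrect' M k)).

Definition f1 (M : R) (k : nat) : R := - ln (p1 M k) / k%:R.
Definition f2 (M : R) (k : nat) : R := - ln (p2 M k) / k%:R.

Definition M_hyp (M : R) : Prop :=
  forall eps : R, 0 < eps -> exists K : nat, forall k n : nat, (K <= k)%N -> (0 < n)%N ->
    3 / 10 * ln (n%:R : R) < k%:R -> k%:R < 13 / 25 * ln (n%:R : R) ->
    PPprob (Sn n) (two_big_comps k (M * Num.sqrt k%:R / 8)) <= eps * expR (- (9 * k%:R)).

End KNN.

(* Main.v *)
(* Both regions are squares of side M sqrt k, so rescaling turns the question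
   into one about a Poisson process of intensity M^2 k on a fixed square, and it
   is enough to show f(k') <= f(k) + eps whenever k is large and k' is large
   depending on k.  Divide the square into n^2 cells, n = 4 r^2.  Cell indices
   determine squared distances up to an error of order n, so the only points
   whose order of distance from a given one is not determined by the cells lie
   in an annulus of relative area O(1/r); by Chernoff's bound all annuli contain
   fewer than eta k points, except with probability much smaller than the
   trivial lower bound exp(-M^2 k) for p(k).  Hence the event at scale k is, up
   to a factor 2, contained in an event on the vector of cell counts, which
   takes polynomially many values: some count vector c has probability at least
   p(k) / poly(k).  Multiplying c by m ~ k'/((1 - eta) k) gives a count vector
   that forces the event at scale k', and (m c)! <= m^(m c) c!^m shows that its
   probability is at least about p(k)^m. *)
Require Import Defs.
From HB Require Import structures.
From mathcomp Require Import all_boot all_order all_algebra.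
From mathcomp Require Import all_classical all_reals all_analysis.
From mathcomp Require Import measurable_realfun ring lra zify.
Set Implicit Arguments.
Unset Strict Implicit.
Unset Printing Implicit Defensive.
Import Order.TTheory GRing.Theory Num.Theory.
Import numFieldNormedType.Exports.
Local Open Scope classical_set_scope.
Local Open Scope ring_scope.

(** * Integrals of functions of cells *)

Section DiscreteMint.
Context {R : realType} {T : finType}.
Implicit Types (v : T -> R) (g h : seq T -> R).

(** The finite counterpart of [mint]: for an integrand that depends only on the cells of the points,
    each integration is a sum over cells weighted by their areas [v]. *)
Fixpoint dint v (m : nat) g : R :=
  match m with
  | 0 => g [::]
  | m'.+1 => \sum_i v i * dint v m' (fun t => g (i :: t))
  end.

Lemma dint_ge0 v m g : (forall i, 0 <= v i) -> (forall t, 0 <= g t) ->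
  0 <= dint v m g.
Proof.
move=> v0; elim: m g => [|m IH] g g0 //=.
by apply: sumr_ge0 => i _; rewrite mulr_ge0 // IH.
Qed.

Lemma le_dint v m g h : (forall i, 0 <= v i) ->
  (forall t, size t = m -> g t <= h t) -> dint v m g <= dint v m h.
Proof.
move=> v0; elim: m g h => [|m IH] g h gh /=; first exact: gh.
by apply: ler_sum => i _; rewrite ler_wpM2l // IH // => t st; apply: gh; rewrite /= st.
Qed.

Lemma eq_dint v m g h :
  (forall t, size t = m -> g t = h t) -> dint v m g = dint v m h.
Proof.
elim: m g h => [|m IH] g h gh /=; first exact: gh.
by apply: eq_bigr => i _; congr (_ * _); apply: IH => t st; apply: gh; rewrite /= st.
Qed.

Lemma dint_sum (I : Type) (r : seq I) (P : pred I) v m (g : I -> seq T -> R) :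
  dint v m (fun t => \sum_(c <- r | P c) g c t) =
  \sum_(c <- r | P c) dint v m (g c).
Proof.
elim: m g => [|m IH] g //=.
rewrite exchange_big /=; apply: eq_bigr => i _.
by rewrite IH mulr_sumr.
Qed.

Lemma dintZ v m a g : dint v m (fun t => a * g t) = a * dint v m g.
Proof.
elim: m g => [|m IH] g //=.
by rewrite mulr_sumr; apply: eq_bigr => i _; rewrite IH mulrCA.
Qed.

(** A product weight factorizes over the letters; this supplies the exponential moments in
    [chernoff]. *)
Lemma dint_prod v (h : T -> R) m :
  dint v m (fun t => \prod_(i <- t) h i) = (\sum_i v i * h i) ^+ m.
Proof.
elim: m => [|m IH] /=; first by rewrite big_nil.
rewrite exprS mulr_suml; apply: eq_bigr => i _.
rewrite -mulrA; congr (_ * _).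
under eq_dint => t _ do rewrite big_cons.
by rewrite dintZ IH.
Qed.

Lemma dint1 v m : dint v m (fun=> 1) = (\sum_i v i) ^+ m.
Proof.
have := dint_prod v (fun=> 1) m.
under [in RHS]eq_bigr => i _ do rewrite mulr1.
by move=> <-; apply: eq_dint => t _; rewrite big1.
Qed.

End DiscreteMint.

Section IntegralMonotone.
Local Open Scope ereal_scope.
Context d (X : measurableType d) (R : realType).
Variable mu : {measure set X -> \bar R}.
Import HBNNSimple.

(* Unlike [ge0_le_integral], no measurability: the integral of a nonnegative
   function is a supremum over the simple functions below it. *)
Lemma le_integral_nonneg (f g : X -> \bar R) :
  (forall x, 0 <= f x) -> (forall x, f x <= g x) ->
  \int[mu]_x f x <= \int[mu]_x g x.
Proof.
move=> f0 fg.
have g0 x : 0 <= g x by exact: le_trans (f0 x) (fg x).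
rewrite (ge0_integralTE mu f0) (ge0_integralTE mu g0).
apply: ereal_sup_le => _ [h hf <-]; exists h => // x.
exact: le_trans (hf x) (fg x).
Qed.

End IntegralMonotone.

Section Mint.
Local Open Scope ereal_scope.
Context {R : realType}.
Implicit Types (Q : set (pt R)) (f g : seq (pt R) -> \bar R).

Lemma mint_ge0 Q m f : (forall s, 0 <= f s) -> 0 <= mint R Q m f.
Proof.
elim: m f => [|m IH] f f0 //=.
apply: integral_ge0 => x _; apply: integral_ge0 => y _.
by rewrite mule_ge0 ?lee_fin ?IH.
Qed.

Lemma le_mint Q m f g : (forall s, 0 <= f s) ->
  (forall s, {in s, forall p, Q p} -> f s <= g s) ->
  mint R Q m f <= mint R Q m g.
Proof.
elim: m f g => [|m IH] f g f0 fg /=; first by apply: fg => p; rewrite in_nil.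
have F0 x y : 0 <= (\1_Q (x, y))%:E * mint R Q m (fun t => f ((x, y) :: t)).
  by rewrite mule_ge0 ?lee_fin ?mint_ge0.
apply: le_integral_nonneg => x; first exact: integral_ge0.
apply: le_integral_nonneg => y //.
rewrite indicE; case: (boolP ((x, y) \in Q)) => [|_] /=; last by rewrite !mul0e.
rewrite inE => Qxy; rewrite !mul1e; apply: IH => // t Qt; apply: fg => p.
by rewrite inE => /predU1P[->//|/Qt].
Qed.

End Mint.

Section CellIntegral.
Local Open Scope ereal_scope.
Context {R : realType} {I : finType}.
Let mu := @lebesgue_measure R.
Variables (A : set R) (tau : R -> I) (w : I -> R).
Hypothesis mA : forall i, measurable (A `&` tau @^-1` [set i]).
Hypothesis muA : forall i, mu (A `&` tau @^-1` [set i]) = (w i)%:E.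

Lemma cell_integrandE (h : I -> R) x :
  (\1_A x * h (tau x))%R%:E =
  \sum_i (h i)%:E * (\1_(A `&` tau @^-1` [set i]) x)%:E.
Proof.
rewrite (bigD1 (tau x)) //= big1 ?adde0; last first.
  move=> i ix; rewrite indicE; case: (boolP (x \in _)) => [|_]; last by rewrite mule0.
  by rewrite inE => -[_ /= /esym e]; rewrite e eqxx in ix.
rewrite -EFinM; congr (_%:E); rewrite mulrC; congr (_ * _)%R.
rewrite !indicE; congr (_%:R); congr nat_of_bool.
by apply/idP/idP; rewrite !inE; [move=> Ax; split | case].
Qed.

Lemma cell_integral (h : I -> R) : (forall i, (0 <= h i)%R) ->
  \int[mu]_x (\1_A x * h (tau x))%R%:E = (\sum_i w i * h i)%R%:E.
Proof.
move=> h0.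
under eq_integral => x _ do rewrite cell_integrandE.
rewrite ge0_integral_sum//.
- rewrite -sumEFin; apply: eq_bigr => i _.
  rewrite ge0_integralZl_EFin//; last first.
    by apply/measurable_EFinP; exact: measurable_indic (mA i).
  have -> : \int[mu]_x (\1_(A `&` tau @^-1` [set i]) x)%:E = (w i)%:E.
    rewrite -(muA i) -[in RHS](setIT (A `&` _)).
    exact: (integral_indic mu measurableT (mA i)).
  by rewrite -EFinM mulrC.
- move=> i; apply: emeasurable_funM; first exact: measurable_cst.
  by apply/measurable_EFinP; exact: measurable_indic (mA i).
- by move=> i x _; rewrite -EFinM lee_fin mulr_ge0.
Qed.

End CellIntegral.

(** * Two-sided bounds on Poisson probabilities by sums over cells *)

Section CellMint.
Local Open Scope ereal_scope.
Context {R : realType} {I : finType}.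
Let mu := @lebesgue_measure R.
Variables (A1 A2 : set R) (tau1 tau2 : R -> I) (w1 w2 : I -> R).
Hypothesis mA1 : forall i, measurable (A1 `&` tau1 @^-1` [set i]).
Hypothesis muA1 : forall i, mu (A1 `&` tau1 @^-1` [set i]) = (w1 i)%:E.
Hypothesis mA2 : forall i, measurable (A2 `&` tau2 @^-1` [set i]).
Hypothesis muA2 : forall i, mu (A2 `&` tau2 @^-1` [set i]) = (w2 i)%:E.

Definition cell2 (p : pt R) : I * I := (tau1 p.1, tau2 p.2).
Definition wt2 (c : I * I) : R := (w1 c.1 * w2 c.2)%R.

Lemma wt_ge0 (A : set R) (tau : R -> I) (w : I -> R)
  (muA : forall i, mu (A `&` tau @^-1` [set i]) = (w i)%:E) i : (0 <= w i)%R.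
Proof. by rewrite -lee_fin -muA. Qed.

Lemma wt2_ge0 c : (0 <= wt2 c)%R.
Proof. by rewrite mulr_ge0 ?(wt_ge0 muA1) ?(wt_ge0 muA2). Qed.

(** Induction on the number of points: the integral over the remaining points depends only on the
    cell of the first one, so both one-dimensional integrals are those of step functions. *)
Lemma mint_cell m (g : seq (I * I) -> R) : (forall t, (0 <= g t)%R) ->
  mint R (A1 `*` A2) m (fun s => (g (map cell2 s))%:E) = (dint wt2 m g)%:E.
Proof.
elim: m g => [|m IH] g g0 //=.
pose H (c : I * I) := dint wt2 m (fun t => g (c :: t)).
have H0 c : (0 <= H c)%R by apply: dint_ge0 => //; exact: wt2_ge0.
transitivity (\int[mu]_x (\1_A1 x * \sum_j w2 j * H (tau1 x, j))%R%:E).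
  apply: eq_integral => x _.
  rewrite EFinM -(cell_integral mA2 muA2)// -ge0_integralZl_EFin//.
  - apply: eq_integral => y _.
    rewrite (IH (fun t => g (cell2 (x, y) :: t)))//.
    rewrite -!EFinM mulrA; congr (_ * _)%:E%R.
    rewrite !indicE -natrM mulnb; congr (nat_of_bool _)%:R.
    apply/idP/andP; rewrite !inE; first by case.
    by case.
  - by move=> y _; rewrite lee_fin mulr_ge0.
  - apply/measurable_EFinP.
    have -> : (fun y => \1_A2 y * H (tau1 x, tau2 y))%R = 
      (fun y => \sum_j H (tau1 x, j) * \1_(A2 `&` tau2 @^-1` [set j]) y)%R.
      apply/funext => y; apply/EFin_inj.
      rewrite (cell_integrandE _ _ (fun j => H (tau1 x, j))).
      by rewrite -sumEFin; apply: eq_bigr.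
    apply: measurable_sum => j; apply: measurable_funM; first exact: measurable_cst.
    exact: measurable_indic (mA2 j).
rewrite (@cell_integral _ _ _ _ _ mA1 muA1 (fun i => \sum_j w2 j * H (i, j))%R); last first.
  by move=> i; apply: sumr_ge0 => j _; rewrite mulr_ge0 ?(wt_ge0 muA2).
congr (_%:E); transitivity (\sum_i \sum_j wt2 (i, j) * H (i, j))%R.
  by apply: eq_bigr => i _; rewrite mulr_sumr; apply: eq_bigr => j _; rewrite mulrA.
by rewrite pair_bigA; apply: eq_bigr => -[].
Qed.

Let Q := A1 `*` A2.
Let V := (\sum_c wt2 c)%R.

Lemma area_cell : area R Q = V%:E.
Proof.
rewrite /area (mint_cell 1 (g := fun=> 1%R))//= /V.
by congr (_%:E); apply: eq_bigr => c _; rewrite mulr1.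
Qed.

Let term (E : seq (pt R) -> Prop) m : \bar R :=
  (expR (- fine (area R Q)) / (m`!)%:R)%:E * mint R Q m (fun s => (\1_E s)%:E).

Let term_ge0 E m : 0 <= term E m.
Proof.
rewrite /term mule_ge0 ?lee_fin ?divr_ge0 ?expR_ge0//.
by apply: mint_ge0 => s; rewrite lee_fin.
Qed.

Let term_le (E : seq (pt R) -> Prop) (g : seq (I * I) -> R) m : (forall t, (0 <= g t)%R) ->
  (forall s, {in s, forall p, Q p} -> E s -> (1 <= g (map cell2 s))%R) ->
  term E m <= (expR (- V) / m`!%:R * dint wt2 m g)%R%:E.
Proof.
move=> g0 Eg; rewrite /term area_cell /= [leRHS]EFinM.
apply: lee_wpmul2l; first by rewrite lee_fin divr_ge0 ?expR_ge0.
rewrite -mint_cell//; apply: le_mint => s; first by rewrite lee_fin.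
move=> Qs; rewrite lee_fin indicE; case: (boolP (s \in _)) => //=.
by rewrite inE => /(Eg s Qs).
Qed.

Lemma PPseries_le (E : seq (pt R) -> Prop) (g : seq (I * I) -> R) B :
  (forall t, (0 <= g t)%R) ->
  (forall s, {in s, forall p, Q p} -> E s -> (1 <= g (map cell2 s))%R) ->
  (forall N, (\sum_(0 <= m < N) expR (- V) / m`!%:R * dint wt2 m g <= B)%R) ->
  \sum_(m <oo) term E m <= B%:E.
Proof.
move=> g0 Eg sumB.
apply: lime_le; first by apply: is_cvg_nneseries => m _ _; exact: term_ge0.
near=> N; apply: (@le_trans _ _ (\sum_(0 <= m < N) (expR (- V) / m`!%:R * dint wt2 m g)%R%:E)).
  by apply: lee_sum => m _; exact: term_le.
by rewrite sumEFin lee_fin.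
Unshelve. all: by end_near. Qed.

Lemma PPprob_le (E : seq (pt R) -> Prop) (g : seq (I * I) -> R) B :
  (forall t, (0 <= g t)%R) ->
  (forall s, {in s, forall p, Q p} -> E s -> (1 <= g (map cell2 s))%R) ->
  (forall N, (\sum_(0 <= m < N) expR (- V) / m`!%:R * dint wt2 m g <= B)%R) ->
  (PPprob R Q E <= B)%R.
Proof.
move=> g0 Eg sumB; have := PPseries_le g0 Eg sumB.
rewrite /PPprob -/(term E).
(* Nonnegativity excludes [-oo] and the bound excludes [+oo], the two values that [fine] would
   replace by 0. *)
have : 0 <= \sum_(m <oo) term E m by apply: nneseries_ge0 => m _ _; exact: term_ge0.
by case: (\sum_(m <oo) term E m) => [x| |] //=; rewrite lee_fin.
Qed.

Lemma sum_exp_le (x : R) N : (0 <= x)%R -> (\sum_(0 <= m < N) x ^+ m / m`!%:R <= expR x)%R.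
Proof.
move=> x0; apply: (nondecreasing_cvgn_le _ (is_cvg_series_exp_coeff x) N).
by apply: nondecreasing_series => i _ _; exact: exp_coeff_ge0.
Qed.

(** A single term of the nonnegative series is kept. *)
Lemma PPprob_ge (E : seq (pt R) -> Prop) (P : pred (seq (I * I))) m :
  (forall s, {in s, forall p, Q p} -> P (map cell2 s) -> E s) ->
  (expR (- V) / m`!%:R * dint wt2 m (fun t => (P t)%:R) <= PPprob R Q E)%R.
Proof.
move=> PE.
have V0 : (0 <= V)%R by apply: sumr_ge0 => c _; exact: wt2_ge0.
(* The total mass is at most 1, so the series is finite and [fine] does not collapse it to 0. *)
have le1 : \sum_(m <oo) term E m <= 1%R%:E.
  apply: (@PPseries_le _ (fun=> 1%R)) => // N.
  under eq_bigr => i _ do rewrite dint1 -/V -mulrA (mulrC _^-1)%R.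
  rewrite -mulr_sumr expRN mulrC ler_pdivrMr ?expR_gt0// mul1r.
  exact: sum_exp_le.
have ge0 k : 0 <= term E k by exact: term_ge0.
have lem : term E m <= \sum_(m <oo) term E m.
  apply: le_trans (nneseries_lim_ge m.+1 _) => //.
  by rewrite big_nat_recr//= leeDr// sume_ge0.
rewrite /PPprob -/(term E) -lee_fin fineK; last first.
  rewrite ge0_fin_numE; first by apply: le_lt_trans le1 _; rewrite ltry.
  by apply: nneseries_ge0 => k _ _; exact: ge0.
apply: le_trans lem; rewrite /term area_cell /= [leLHS]EFinM.
apply: lee_wpmul2l; first by rewrite lee_fin divr_ge0 ?expR_ge0.
rewrite -mint_cell//; apply: le_mint => s; first by rewrite lee_fin.
move=> Qs; rewrite lee_fin; case: (boolP (P _)) => [Ps|_] //=.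
by rewrite indicE mem_set//; exact: PE.
Qed.

End CellMint.

(** * Poisson cell counts *)

Section WordCounts.
Context {R : realType} {T : finType}.
Implicit Types (v : T -> R) (c : {ffun T -> nat}) (t : seq T).

Definition content t : {ffun T -> nat} := [ffun i => count_mem i t].

Lemma content_cons i t c :
  (content (i :: t) == c) = (0 < c i)%N && (content t == [ffun j => c j - (j == i)]%N).
Proof.
apply/eqP/andP => [<-|[ci /eqP ct]].
  split; first by rewrite ffunE /= eqxx.
  by apply/eqP/ffunP => j; rewrite !ffunE /= (eq_sym j); case: (i == j); lia.
apply/ffunP => j; have /ffunP/(_ j) := ct; rewrite !ffunE /= => ->.
by rewrite (eq_sym i); case: eqVneq => [->|_]; lia.
Qed.

Lemma sum_content (A : pred T) t : (\sum_(i | A i) content t i)%N = count A t.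
Proof.
elim: t => [|x t IH]; first by rewrite big1 // => i _; rewrite ffunE.
rewrite /= -IH.
have -> : (A x = \sum_(i | A i) (i == x) :> nat)%N.
  case: (boolP (A x)) => Ax.
    by rewrite (bigD1 x) //= eqxx big1 // => i /andP[_ /negbTE ->].
  by rewrite big1 // => i Ai; case: eqVneq => // ix; rewrite -ix Ai in Ax.
rewrite -big_split /=; apply: eq_bigr => i _.
by rewrite !ffunE /= eq_sym.
Qed.

Lemma size_content t : (\sum_i content t i)%N = size t.
Proof.
by rewrite sum_content count_predT.
Qed.

(** The multinomial formula, by induction on the first letter. *)
Lemma dint_content v c m : (\sum_i c i)%N = m ->
  dint v m (fun t => (content t == c)%:R) = m`!%:R * \prod_i (v i ^+ c i / (c i)`!%:R).
Proof.
elim: m c => [|m IH] c cm /=.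
  have c0 i : c i = 0%N by apply/eqP; move/eqP: cm; rewrite sum_nat_eq0 => /forallP/(_ i).
  rewrite big1 => [|i _]; last by rewrite c0 expr0 divr1.
  by rewrite mulr1; congr (_%:R); apply/eqP; rewrite eqb1; apply/eqP/ffunP => i; rewrite ffunE c0.
(* The factor [m.+1] of the factorial is written as [\sum_i c i]; the words that begin with [i]
   account for the share [c i]. *)
rewrite factS natrM -cm natr_sum !mulr_suml; apply: eq_bigr => i _.
case: (posnP (c i)) => [ci|ci].
  have -> : dint v m (fun t => (content (i :: t) == c)%:R) = 0.
    rewrite -(mul0r (dint v m (fun=> 0))) -dintZ; apply: eq_dint => t _.
    by rewrite content_cons ci mul0r.
  by rewrite ci mulr0 !mul0r.
pose c' := [ffun j => c j - (j == i)]%N.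
rewrite (@eq_dint _ _ _ _ _ (fun t => (content t == c')%:R)); last first.
  by move=> t _; rewrite content_cons ci.
rewrite IH; last first.
  apply/succn_inj; rewrite -cm (bigD1 i) //= [in RHS](bigD1 i) //= /c' ffunE eqxx.
  rewrite (eq_bigr c) => [|j /negbTE ji]; first by rewrite subn1 -addSn prednK.
  by rewrite ffunE ji subn0.
rewrite mulrCA -!mulrA; rewrite [in RHS]mulrCA; congr (_ * _).
rewrite (bigD1 i) //= [in RHS](bigD1 i) //= !mulrA; congr (_ * _).
  rewrite /c' ffunE eqxx subn1; case: (c i) ci => // n _ /=.
  rewrite exprS factS natrM; field.
  by rewrite nat1r !pnatr_eq0 -!lt0n fact_gt0.
by apply: eq_bigr => j /negbTE ji; rewrite /c' ffunE ji subn0.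
Qed.

(** The joint law of independent Poisson counts with means [v i]. *)
Definition poisson_pmf v c : R :=
  expR (- \sum_i v i) * \prod_i (v i ^+ c i / (c i)`!%:R).

Lemma poisson_pmf_ge0 v c : (forall i, 0 <= v i) -> 0 <= poisson_pmf v c.
Proof.
move=> v0; rewrite mulr_ge0 ?expR_ge0 ?prodr_ge0 // => i _.
by rewrite divr_ge0 ?exprn_ge0.
Qed.

Lemma poisson_pmf_dint v c :
  poisson_pmf v c = expR (- \sum_i v i) / (\sum_i c i)%N`!%:R *
    dint v (\sum_i c i)%N (fun t => (content t == c)%:R).
Proof.
by rewrite (dint_content _ erefl) /poisson_pmf mulrA divfK // pnatr_eq0 -lt0n fact_gt0.
Qed.

(** Markov's inequality for [expR (s * count)]: giving each letter of [B] the weight [expR s] leads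
    to an exponential series, by [dint_prod]. The case [s = 0] bounds the total mass by 1. *)
Lemma chernoff v (B : pred T) (s a : R) N : (forall i, 0 <= v i) -> 0 <= s ->
  \sum_(0 <= m < N) expR (- \sum_i v i) / m`!%:R *
      dint v m (fun t => (a <= (count B t)%:R)%R%:R)
    <= expR ((\sum_(i | B i) v i) * (expR s - 1) - s * a).
Proof.
move=> v0 s0; set V := \sum_i v i; set W := \sum_(i | B i) v i.
pose h i : R := if B i then expR s else 1.
have sumh : \sum_i v i * h i = V + W * (expR s - 1).
  have -> : W = \sum_i (if B i then v i else 0) by rewrite /W big_mkcond.
  rewrite mulr_suml /V -big_split /=; apply: eq_bigr => i _.
  by rewrite /h; case: (B i); ring.
have hE t : \prod_(i <- t) h i = expR (s * (count B t)%:R).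
  elim: t => [|x t IH]; first by rewrite big_nil mulr0 expR0.
  by rewrite big_cons IH /= /h natrD mulrDr expRD; case: (B x); rewrite ?mulr1 ?mulr0 ?expR0.
have step m : dint v m (fun t => (a <= (count B t)%:R)%R%:R) <=
    expR (- (s * a)) * (V + W * (expR s - 1)) ^+ m.
  rewrite -sumh -dint_prod -dintZ; apply: le_dint => // t _.
  rewrite hE -expRD; case: (lerP a) => [at_|_]; last exact: expR_ge0.
  by rewrite mulr1n -[X in X <= _]expR0 ler_expR addrC subr_ge0 ler_wpM2l.
apply: (@le_trans _ _ (\sum_(0 <= m < N) expR (- V - s * a) *
    ((V + W * (expR s - 1)) ^+ m / m`!%:R))).
  apply: ler_sum => m _; rewrite expRD -!mulrA ler_wpM2l ?expR_ge0 //.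
  by rewrite mulrC mulrA ler_wpM2r ?invr_ge0.
rewrite -mulr_sumr.
apply: (@le_trans _ _ (expR (- V - s * a) * expR (V + W * (expR s - 1)))).
  rewrite ler_wpM2l ?expR_ge0 // sum_exp_le // -sumh sumr_ge0 // => i _.
  by rewrite mulr_ge0 // /h; case: (B i) => //; exact: expR_ge0.
by rewrite -expRD ler_expR; lra.
Qed.

(** Words are grouped by count vector. With at most [K] letters every count fits in ['I_K.+1], and
    each vector belongs to words of one length only, so it is counted for at most one [m]. *)
Lemma sum_good_le v (good : pred {ffun T -> nat}) K N : (forall i, 0 <= v i) ->
  \sum_(0 <= m < N) expR (- \sum_i v i) / m`!%:R *
      dint v m (fun t => ((size t <= K)%N && good (content t))%:R)
    <= \sum_(c : {ffun T -> 'I_K.+1} | good [ffun i => c i : nat] && (\sum_i c i <= K)%N)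
         poisson_pmf v [ffun i => c i : nat].
Proof.
move=> v0.
pose cc (c : {ffun T -> 'I_K.+1}) : {ffun T -> nat} := [ffun i => c i : nat].
have sumcc (c : {ffun T -> 'I_K.+1}) : (\sum_i cc c i = \sum_i c i)%N by apply: eq_bigr => i _; rewrite ffunE.
pose P (c : {ffun T -> 'I_K.+1}) := good (cc c) && (\sum_i c i <= K)%N.
have step m : expR (- \sum_i v i) / m`!%:R *
      dint v m (fun t => ((size t <= K)%N && good (content t))%:R) <=
    \sum_(c : {ffun T -> 'I_K.+1} | P c) ((\sum_i c i)%N == m)%:R * poisson_pmf v (cc c).
  have -> : \sum_(c : {ffun T -> 'I_K.+1} | P c) ((\sum_i c i)%N == m)%:R * poisson_pmf v (cc c) =
    expR (- \sum_i v i) / m`!%:R *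
      dint v m (fun t => \sum_(c : {ffun T -> 'I_K.+1} | P c) ((\sum_i c i)%N == m)%:R * (content t == cc c)%:R).
    rewrite dint_sum mulr_sumr; apply: eq_bigr => c _; rewrite dintZ.
    case: eqP => [cm|_]; last by rewrite mulr0n !mul0r mulr0.
    by rewrite mulr1n !mul1r poisson_pmf_dint sumcc cm.
  rewrite ler_wpM2l ?divr_ge0 ?expR_ge0 //; apply: le_dint => // t st.
  case: (boolP (_ && _)) => [/andP[tK gt]|_]; last by apply: sumr_ge0 => d _; rewrite mulr_ge0.
  have lt i : (content t i < K.+1)%N.
    by rewrite ltnS (leq_trans _ tK) // -size_content (bigD1 i) //= leq_addr.
  pose c := [ffun i => Ordinal (lt i)].
  have ccE : cc c = content t by apply/ffunP => i; rewrite !ffunE.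
  rewrite (bigD1 c) /=; last by rewrite /P ccE gt -sumcc ccE size_content.
  by rewrite -sumcc ccE size_content st !eqxx mulr1 lerDl sumr_ge0.
apply: le_trans (ler_sum _ (fun m _ => step m)) _.
rewrite exchange_big /=; apply: ler_sum => c _.
rewrite -mulr_suml -[leRHS]mul1r ler_wpM2r ?poisson_pmf_ge0 //.
rewrite -natr_sum lern1.
case: (ltnP (\sum_i c i)%N N) => sN; last first.
  rewrite big_nat big1 // => i /andP[_ iN]; apply/eqP; rewrite eqb0.
  by apply/negP => /eqP e; move: iN; rewrite -e ltnNge sN.
rewrite big_mkord (bigD1 (Ordinal sN)) //= eqxx big1 ?addn0 // => i.
by rewrite -val_eqE /= eq_sym => /negbTE ->.
Qed.

(** Pigeonhole: there are at most [K.+1 ^ #|T|] candidate vectors, a number polynomial in [K]. *)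
Lemma exists_ge_average v (good : pred {ffun T -> nat}) K (B : R) :
  (forall i, 0 <= v i) -> 0 < B ->
  B <= \sum_(c : {ffun T -> 'I_K.+1} | good [ffun i => c i : nat] && (\sum_i c i <= K)%N)
         poisson_pmf v [ffun i => c i : nat] ->
  exists c : {ffun T -> nat}, [/\ good c, (\sum_i c i <= K)%N &
    B / K.+1%:R ^+ #|T| <= poisson_pmf v c].
Proof.
move=> v0 B0 Bsum.
have pos : 0 < K.+1%:R ^+ #|T| :> R by rewrite exprn_gt0.
case: (boolP [exists c : {ffun T -> 'I_K.+1}, [&& good [ffun i => c i : nat],
   (\sum_i c i <= K)%N & B / K.+1%:R ^+ #|T| <= poisson_pmf v [ffun i => c i : nat]]]).
  case/existsP => c /and3P[g s le]; exists [ffun i => c i : nat]; split => //.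
  by under eq_bigr => i _ do rewrite ffunE.
move/existsPn => H; exfalso.
have : \sum_(c : {ffun T -> 'I_K.+1} | good [ffun i => c i : nat] && (\sum_i c i <= K)%N)
         poisson_pmf v [ffun i => c i : nat] < B.
  (* The strict comparison of sums uses a nonempty index set; an empty sum is 0, which is below
     [B]. *)
  have [[c0 Pc0]|none] := pselect (exists c : {ffun T -> 'I_K.+1},
     good [ffun i => c i : nat] && (\sum_i c i <= K)%N); last first.
    by rewrite big1 // => c Pc; case: none; exists c.
  apply: (@lt_le_trans _ _ (\sum_(c : {ffun T -> 'I_K.+1} |
     good [ffun i => c i : nat] && (\sum_i c i <= K)%N) B / K.+1%:R ^+ #|T|)).
    apply: ltr_sum; first by apply/hasP; exists c0; rewrite // mem_index_enum.
    move=> c /andP[g s]; rewrite ltNge; apply/negP => le.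
    by move/negP: (H c); apply; rewrite g s.
  rewrite sumr_const -[X in X <= _]mulr_natr -mulrA -[leRHS]mulr1 ler_wpM2l ?(ltW B0) //.
  rewrite ler_pdivrMl // mulr1 -natrX ler_nat (leq_trans (max_card _)) //.
  by rewrite card_ffun card_ord.
by rewrite ltNge Bsum.
Qed.

(** From [n] to [n.+1] the factorial on the left gains [m] factors, each at most [m * n.+1]. *)
Lemma fact_mul_le m n : ((m * n)`! <= m ^ (m * n) * n`! ^ m)%N.
Proof.
elim: n => [|n IH]; first by rewrite muln0 expn0 fact0 exp1n.
have aux k : (k <= m)%N -> ((m * n + k)`! <= (m * n)`! * (m * n.+1) ^ k)%N.
  elim: k => [|k IHk] km; first by rewrite addn0 expn0 muln1.
  rewrite addnS factS expnSr mulnA [leqLHS]mulnC leq_mul //; first exact: IHk (ltnW km).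
  by rewrite mulnS [ltnLHS]addnC ltn_add2r.
have := aux m (leqnn m); rewrite -mulnSr => /leq_trans; apply.
rewrite factS !expnMn mulnSr expnD [X in (_ <= _ * X)%N]mulnC mulnACA.
exact: leq_mul.
Qed.

(** [fact_mul_le] compares the factorials cell by cell, [y <= m%:R * x] compares the exponentials,
    and the ratio [y / (m%:R * x)] turns each mean [x * w i] into [y * w i / m]. *)
Lemma poisson_pmf_scale (w : T -> R) (x y : R) m c :
  (forall i, 0 <= w i) -> 0 < x -> 0 < y -> (0 < m)%N -> y <= m%:R * x ->
  ((y / (m%:R * x)) ^+ (\sum_i c i)%N * poisson_pmf (fun i => x * w i) c) ^+ m
    <= poisson_pmf (fun i => y * w i) [ffun i => (m * c i)%N].
Proof.
move=> w0 x0 y0 m0 yx.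
have m0' : 0 < m%:R :> R by rewrite ltr0n.
rewrite /poisson_pmf -!mulr_sumr mulrCA exprMn -expRM_natl.
have r0 : 0 < y / (m%:R * x) by rewrite divr_gt0 // mulr_gt0.
have vw i : 0 <= x * w i by rewrite mulr_ge0 // ltW.
apply: ler_pM; first exact: expR_ge0.
- apply/exprn_ge0/mulr_ge0; first by rewrite exprn_ge0 // ltW.
  by apply: prodr_ge0 => i _; rewrite divr_ge0 ?exprn_ge0.
- by rewrite ler_expR mulrN lerN2 mulrA ler_wpM2r // sumr_ge0.
rewrite -prodrXr -big_split /= -prodrXl; apply: ler_prod => i _.
have f0 n : 0 < n`!%:R :> R by rewrite ltr0n fact_gt0.
apply/andP; split.
  by apply/exprn_ge0/mulr_ge0; [rewrite exprn_ge0 // ltW | rewrite divr_ge0 ?exprn_ge0].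
rewrite ffunE mulrA -exprMn.
have -> : y / (m%:R * x) * (x * w i) = y * w i / m%:R.
  by field; rewrite !gt_eqF.
rewrite exprMn exprVn -exprM (mulnC (c i)) exprMn -mulrA ler_wpM2l ?exprn_ge0 ?mulr_ge0 ?(ltW y0) //.
rewrite exprVn -invfM lef_pV2 ?posrE ?mulr_gt0 ?exprn_gt0 //.
by rewrite -!natrX -natrM ler_nat fact_mul_le.
Qed.

End WordCounts.

(** * The grid on a square *)

Section Grid.
Context {R : realType}.
Let mu := @lebesgue_measure R.
Variables (n : nat) (a l : R).
Hypotheses (n0 : (0 < n)%N) (l0 : 0 < l).

Definition coord (x : R) : R := n%:R * (x - a) / l.

(* Even indices are the grid points, odd ones the open intervals between them. *)
Definition grid (x : R) : 'I_(n.*2.+1) :=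
  let j := Num.truncn (coord x) in
  inord (if coord x == j%:R then j.*2 else j.*2.+1).

Definition grid_wt (i : 'I_(n.*2.+1)) : R := if odd i then l / n%:R else 0.

Let A : set R := [set x | a <= x <= a + l].

Let n0' : 0 < n%:R :> R. Proof. by rewrite ltr0n. Qed.

Lemma coord_itv x : A x -> 0 <= coord x <= n%:R.
Proof.
rewrite /A /= /coord => /andP[ax xl]; apply/andP; split.
  by rewrite divr_ge0 ?mulr_ge0 ?subr_ge0 // ltW.
by rewrite ler_pdivrMr // ler_wpM2l // lerBlDl.
Qed.

Lemma coordK x y : coord x = y -> x = a + l * y / n%:R.
Proof. by move=> <-; rewrite /coord; field; rewrite !gt_eqF. Qed.

Lemma coord_lt x y : (coord x < y) = (x < a + l * y / n%:R).
Proof.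
rewrite /coord ltr_pdivrMr // -ltrBlDl ltr_pdivlMr //.
by rewrite (mulrC n%:R) (mulrC y).
Qed.

Lemma coord_gt x y : (y < coord x) = (a + l * y / n%:R < x).
Proof.
rewrite /coord ltr_pdivlMr // -ltrBrDl ltr_pdivrMr //.
by rewrite (mulrC n%:R) (mulrC y).
Qed.

Lemma gridP x : A x -> exists j : nat,
  [/\ coord x = j%:R, (j <= n)%N & grid x = j.*2 :> nat] \/
  [/\ j%:R < coord x < j.+1%:R, (j < n)%N & grid x = j.*2.+1 :> nat].
Proof.
move=> /coord_itv/andP[u0 un]; exists (Num.truncn (coord x)).
have /andP[ju uj] := truncn_itv u0; move: ju uj.
rewrite /grid; set j := Num.truncn _ => ju uj; case: eqP => [e|/eqP ne].
  have jn : (j <= n)%N by rewrite -(ler_nat R) -e.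
  by left; split => //; rewrite inordK // ltnS leq_double.
have {}ju : j%:R < coord x by rewrite lt_def ne.
have jn : (j < n)%N by rewrite -(ltr_nat R) (lt_le_trans ju).
right; split => //; first by rewrite ju.
by rewrite inordK // ltnS ltn_double.
Qed.

(** Grid points and intervals alternate in the numbering, so an index compares with twice the
    coordinate. *)
Lemma grid_coord x : A x -> `|(grid x : nat)%:R - 2 * coord x| <= 1.
Proof.
move=> /gridP[j [[-> _ ->]|[/andP[ju uj] _ ->]]].
  by rewrite -mul2n natrM subrr normr0.
rewrite -natr1 in uj; rewrite -natr1 -mul2n natrM ler_norml.
by apply/andP; split; lra.
Qed.

(** Grid points are cells of their own, so the index decides closed inequalities against them
    exactly, boundary included. *)
Lemma grid_ge x (b : nat) : A x -> (b.*2 <= grid x)%N = (b%:R <= coord x).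
Proof.
move=> /gridP[j [[-> _ ->]|[/andP[ju uj] _ ->]]]; first by rewrite leq_double ler_nat.
apply/idP/idP => [bj|bu].
  have : (b <= j)%N by lia.
  by rewrite -(ler_nat R) => /le_trans; apply; exact: ltW.
by have := le_lt_trans bu uj; rewrite ltr_nat; lia.
Qed.

Lemma grid_le x (b : nat) : A x -> (grid x <= b.*2)%N = (coord x <= b%:R).
Proof.
move=> /gridP[j [[-> _ ->]|[/andP[ju uj] _ ->]]]; first by rewrite leq_double ler_nat.
apply/idP/idP => [bj|bu].
  have : (j < b)%N by lia.
  by rewrite -(ler_nat R) => ?; apply: le_trans (ltW uj) _.
by have := lt_le_trans ju bu; rewrite ltr_nat; lia.
Qed.

Lemma grid_cell (i : 'I_(n.*2.+1)) : A `&` grid @^-1` [set i] =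
  if odd i then `]a + l * (i./2)%:R / n%:R, a + l * (i./2).+1%:R / n%:R[%classic
  else [set a + l * (i./2)%:R / n%:R].
Proof.
have inA x : (0 <= coord x) -> (coord x <= n%:R) -> A x.
  rewrite !leNgt coord_gt coord_lt mulr0 mul0r addr0 => h1 h2.
  by rewrite /A /= !leNgt h1 /=; move: h2; rewrite mulfK // gt_eqF.
apply/seteqP; split => x /=.
  move=> [Ax /= <-]; have [j [[uj _ ->]|[uj _ ->]]] := gridP Ax.
    by rewrite odd_double doubleK; exact: coordK.
  by rewrite /= odd_double /= uphalf_double in_itv /= -coord_gt -coord_lt.
have iE := odd_double_half i; have := ltn_ord i.
rewrite ltnS -[X in (X <= _)%N]iE; set j := i./2 in iE *.
move: iE; case: (odd i) => iE ji.
  rewrite add1n ltn_double in ji.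
  move=> xi; have {xi} : x \in `]a + l * j%:R / n%:R, a + l * j.+1%:R / n%:R[ by [].
  rewrite in_itv /= -coord_gt -coord_lt => /andP[ju uj].
  have Ax : A x.
    apply: inA; first by apply: le_trans (ltW ju).
    by apply: le_trans (ltW uj) _; rewrite ler_nat.
  split => //; apply/val_inj; rewrite /= -iE.
  have [k [[uk _ ->]|[/andP[ku uk] _ ->]]] := gridP Ax.
    by move: ju uj; rewrite uk !ltr_nat; lia.
  have := lt_trans ju uk; have := lt_trans ku uj; rewrite !ltr_nat => h1 h2.
  by congr (_.+1); congr double; lia.
rewrite add0n leq_double in ji.
move=> xE; have uj : coord x = j%:R.
  by rewrite xE /coord; field; rewrite !gt_eqF.
have Ax : A x by apply: inA; rewrite uj // ler_nat.
split => //; apply/val_inj; rewrite /= -iE.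
have [k [[uk _ ->]|[/andP[ku uk] _ _]]] := gridP Ax.
  by move/eqP: uk; rewrite uj eqr_nat => /eqP ->.
by move: ku uk; rewrite uj !ltr_nat; lia.
Qed.

Lemma grid_cell_measurable i : measurable (A `&` grid @^-1` [set i]).
Proof.
rewrite grid_cell; case: ifP => _; first exact: measurable_itv.
exact: measurable_set1.
Qed.

Lemma grid_cell_measure i : mu (A `&` grid @^-1` [set i]) = (grid_wt i)%:E.
Proof.
rewrite grid_cell /grid_wt; case: ifP => _; last exact: lebesgue_measure_set1.
rewrite /mu lebesgue_measure_itv /= lte_fin ifT.
  rewrite -EFinB; congr (_%:E); rewrite -natr1; field.
  by rewrite gt_eqF.
by rewrite ltrD2l ltr_pM2r ?invr_gt0 // ltr_pM2l // ltr_nat.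
Qed.

End Grid.

Lemma in_in_set (U : finType) (A : set U) x : (x \in in_set A) = `[< A x >].
Proof. by []. Qed.

Lemma card_count (U : Type) (x0 : U) (s : seq U) (p : pred U) :
  #|[set i : 'I_(size s) | p (nth x0 s i)]| = count p s.
Proof.
rewrite -sum1_card -sum1_count (big_nth x0) big_mkord.
by apply: eq_bigl => i; rewrite in_in_set asboolb.
Qed.

Lemma sub_in_count (U : eqType) (a b : pred U) (s : seq U) :
  {in s, forall x, a x -> b x} -> (count a s <= count b s)%N.
Proof.
elim: s => //= x s IH ab; apply: leq_add.
  by case: (a x) (ab x (mem_head _ _)) => // ->.
by apply: IH => y ys; apply: ab; rewrite inE ys orbT.
Qed.

Lemma content_gt0 (T : finType) (t : seq T) X : (0 < content t X)%N = (X \in t).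
Proof. by rewrite ffunE -has_count has_pred1. Qed.

(** * Components read off from cell counts *)

Section CellGeometry.
Context {R : realType} {T : finType}.
Implicit Types (X Y Z : T) (c : {ffun T -> nat}).
Variables (q : T -> T -> R) (delta : R) (inb : pred T).

(** [q] approximates a rescaled squared distance up to [delta], and comparing two distances involves
    two such errors. Points in cells of [inner X Y] are certainly closer to a point of [X] than a
    point of [Y] is; for cells of [shell X Y] the order is undecided. *)
Definition inner X Y : pred T := fun Z => q X Z < q X Y - 2 * delta.
Definition shell X Y : pred T := fun Z => `|q X Z - q X Y| <= 2 * delta.

(* The points in the cells of P form a union of components because every point
   outside P is preceded by K points that are nearer by a safe margin. *)
Definition separated (K : R) c (P : {set T}) :=
  [&& [exists X in P, (0 < c X)%N],
      [forall X in P, (0 < c X)%N ==> inb X] &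
      [forall X in P, forall Y in ~: P, (0 < c X)%N && (0 < c Y)%N ==>
         (K <= (\sum_(Z | inner X Y Z) c Z)%N%:R) &&
         (K <= (\sum_(Z | inner Y X Z) c Z)%N%:R)]].

Definition good (K : R) c := [exists P, separated K c P].

(** Multiplication by a positive [m] keeps the set of occupied cells and multiplies every count in
    [separated] by [m]. *)
Lemma good_scale (K : R) m c : (0 < m)%N -> good K c ->
  good (m%:R * K) [ffun X => (m * c X)%N].
Proof.
move=> m0 /existsP[P /and3P[/existsP[X /andP[XP cX]] /forallP Pin /forallP Psep]].
apply/existsP; exists P; apply/and3P; split.
- by apply/existsP; exists X; rewrite XP ffunE muln_gt0 m0.
- by apply/forallP => Z; have := Pin Z; rewrite ffunE muln_gt0 m0.
- apply/forallP => Z; apply/implyP => ZP; apply/forallP => Y; apply/implyP => YP.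
  have /implyP/(_ ZP)/forallP/(_ Y)/implyP/(_ YP) := Psep Z.
  have scal A : (\sum_(W | A W) [ffun X => (m * c X)%N] W = m * \sum_(W | A W) c W)%N.
    by rewrite big_distrr /=; apply: eq_bigr => W _; rewrite ffunE.
  rewrite !scal !ffunE !muln_gt0 m0 !natrM !ler_pM2l ?ltr0n //.
Qed.

Variables (kappa : R) (tau : pt R -> T) (Q' : set (pt R)) (s : seq (pt R)).
Hypotheses (kappa0 : 0 < kappa) (q0 : forall X, q X X = 0) (q_ge0 : forall X Y, 0 <= q X Y).
Hypothesis qE : {in s &, forall p p', `|kappa * d2 R p p' - q (tau p') (tau p)| <= delta}.
Hypothesis inbE : {in s, forall p, Q' p <-> inb (tau p)}.

Let t := map tau s.
Let vin (i : 'I_(size s)) : vtx R s i \in s.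
Proof. exact: mem_nth. Qed.

Lemma closer_inner_or_shell x y p : x \in s -> y \in s -> p \in s ->
  d2 R p x < d2 R y x ->
  inner (tau x) (tau y) (tau p) || shell (tau x) (tau y) (tau p).
Proof.
move=> xs ys ps lt; rewrite /inner /shell.
have := qE ps xs; have := qE ys xs; rewrite !ler_norml => /andP[h1 h2] /andP[h3 h4].
have : kappa * d2 R p x < kappa * d2 R y x by rewrite ltr_pM2l.
move=> h5; case: ltP => //= h6.
by apply/andP; split; lra.
Qed.

Lemma inner_closer x y p : x \in s -> y \in s -> p \in s ->
  inner (tau x) (tau y) (tau p) -> d2 R p x < d2 R y x.
Proof.
move=> xs ys ps; rewrite /inner => lt.
have := qE ps xs; have := qE ys xs; rewrite !ler_norml => /andP[h1 h2] /andP[h3 h4].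
by rewrite -(ltr_pM2l kappa0); lra.
Qed.

(** The count may include the point [i] itself, which [knn] leaves out; hence the [k.+1] in
    [near_not_knn]. *)
Let near k (i j : 'I_(size s)) := (k <= count (fun p => (d2 R p (vtx R s i) < d2 R (vtx R s j) (vtx R s i))%R) s)%N.

Lemma not_knn_near k i j : j != i -> ~~ knn R s k i j -> near k i j.
Proof.
rewrite /knn => -> /=; rewrite -leqNgt => /leq_trans; apply.
rewrite -(card_count (0, 0)); apply/subset_leq_card/fintype.subsetP => l.
by rewrite !in_in_set => /asboolP/andP[_ h]; exact/asboolP.
Qed.

Lemma near_not_knn k i j : near k.+1 i j -> ~~ knn R s k i j.
Proof.
rewrite /near -(card_count (0, 0)) (cardD1 i) => h; rewrite /knn negb_and -leqNgt.
apply/orP; right; rewrite -ltnS; apply: leq_trans h _.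
rewrite -add1n leq_add //; first by case: (_ \in _).
apply/subset_leq_card/fintype.subsetP => l.
rewrite inE /= in_in_set => /andP[li /asboolP h].
by rewrite in_in_set; apply/asboolP; apply/andP.
Qed.

(** [P] consists of the cells met by the component [C] of [i]. Between a point of [C] and one
    outside, each has at least [k] points closer to it than the other; fewer than [b] of these lie
    in the shell, the rest in inner cells. *)
Lemma good_of_component k (b : R) : b <= k%:R ->
  (forall X Y, (count (shell X Y) t)%:R < b) ->
  has_comp_inside R k Q' s -> good (k%:R - b) (content t).
Proof.
move=> bk bad [i iQ].
pose C := [set j | connect (knn_adj R s k) i j]%SET.
have sep x y : x \in C -> y \notin C -> near k x y /\ near k y x.
  rewrite !inE => ix iy.
  have xy : y != x by apply: contraNneq iy => ->.
  have : ~~ knn_adj R s k x y.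
    by apply: contra iy => e; apply: connect_trans ix (connect1 e).
  rewrite /knn_adj negb_or => /andP[h1 h2].
  by split; apply: not_knn_near => //; rewrite eq_sym.
have cnt x y : near k x y -> k%:R - b <= (count (inner (tau (vtx R s x)) (tau (vtx R s y))) t)%:R /\
   tau (vtx R s x) <> tau (vtx R s y).
  rewrite /near => h; split.
    have : (k <= count (inner (tau (vtx R s x)) (tau (vtx R s y))) t +
                 count (shell (tau (vtx R s x)) (tau (vtx R s y))) t)%N.
      apply: leq_trans h _; rewrite /t !count_map -count_predUI.
      apply: leq_trans (leq_addr _ _); apply: sub_in_count => p ps /=.
      exact: closer_inner_or_shell.
    rewrite -(ler_nat R) natrD.
    by have := bad (tau (vtx R s x)) (tau (vtx R s y)); lra.
  (* A cell cannot contain points both of [C] and of its complement: [q] vanishes on equal cells, so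
     all the closer points would lie in one shell, which holds fewer than [b <= k] points. *)
  move=> e; have := bad (tau (vtx R s x)) (tau (vtx R s y)).
  apply/negP; rewrite -leNgt (le_trans bk) // ler_nat (leq_trans h) // /t count_map.
  apply: sub_in_count => p ps /= /(closer_inner_or_shell (vin x) (vin y) ps).
  case/orP => //; rewrite /inner /shell -e q0 => h1.
  have d0 := le_trans (normr_ge0 _) (qE ps ps).
  by have := q_ge0 (tau (vtx R s x)) (tau p); lra.
have occ X : (0 < content t X)%N -> exists j, tau (vtx R s j) = X.
  rewrite content_gt0 => /mapP[p ps ->].
  have ip : (index p s < size s)%N by rewrite index_mem.
  by exists (Ordinal ip); rewrite /vtx nth_index.
have iC : i \in C by rewrite inE.
have mem_t j : (0 < content t (tau (vtx R s j)))%N.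
  by rewrite content_gt0; apply: map_f.
apply/existsP; exists [set tau (vtx R s j) | j in C]%SET; apply/and3P; split.
- by apply/existsP; exists (tau (vtx R s i)); rewrite mem_t andbT; apply: imset_f.
- apply/forallP => X; apply/implyP => /imsetP[j jC ->]; apply/implyP => _.
  by apply/inbE => //; apply: iQ; rewrite inE in jC.
- apply/forallP => X; apply/implyP => /imsetP[x xC ->].
  apply/forallP => Y; apply/implyP => YC; apply/implyP => /andP[_ /occ[y yY]].
  have yC : y \notin C.
    by apply/negP => yC; move: YC; rewrite inE -yY imset_f.
  have [/cnt[h1 _] /cnt[h2 _]] := sep x y xC yC.
  by rewrite -yY !sum_content h1 h2.
Qed.

(** No edge leaves the set of vertices with cell in [P], since either end has at least [k.+1] points
    certainly closer than the other end. A component that starts in [P] therefore stays there. *)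
Lemma component_of_good k (K : R) : k.+1%:R <= K ->
  good K (content t) -> has_comp_inside R k Q' s.
Proof.
move=> kK /existsP[P /and3P[/existsP[X /andP[XP]]]].
rewrite content_gt0 => /mapP[p ps XE] /forallP Pin /forallP Psep.
have mem_t j : (0 < content t (tau (vtx R s j)))%N.
  by rewrite content_gt0; apply: map_f.
have nadj x y : tau (vtx R s x) \in P -> tau (vtx R s y) \notin P ->
    ~~ knn_adj R s k x y /\ ~~ knn_adj R s k y x.
  move=> xP yP.
  have /implyP/(_ xP)/forallP/(_ (tau (vtx R s y)))/implyP := Psep (tau (vtx R s x)).
  rewrite inE => /(_ yP)/implyP; rewrite !mem_t => /(_ isT) /andP[].
  rewrite !sum_content => /(le_trans kK) h1 /(le_trans kK) h2.
  suff : ~~ knn R s k x y /\ ~~ knn R s k y x.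
    by rewrite /knn_adj => -[/negbTE -> /negbTE ->].
  split; apply: near_not_knn.
    move: h1; rewrite ler_nat => /leq_trans; apply; rewrite /t count_map.
    by apply: sub_in_count => z zs /=; exact: inner_closer.
  move: h2; rewrite ler_nat => /leq_trans; apply; rewrite /t count_map.
  by apply: sub_in_count => z zs /=; exact: inner_closer.
have ip : (index p s < size s)%N by rewrite index_mem.
exists (Ordinal ip) => j ij.
have cl : fingraph.closed (knn_adj R s k) [pred x | tau (vtx R s x) \in P].
  move=> x y xy; rewrite !inE; apply/idP/idP => [xP|yP]; apply/negPn/negP => nP.
    by have [] := nadj _ _ xP nP; rewrite xy.
  by have [_] := nadj _ _ yP nP; rewrite xy.
have jP : tau (vtx R s j) \in P.
  have /= := closed_connect cl ij.
  by rewrite !inE /vtx nth_index // -XE XP => <-.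
apply/inbE => //; have /implyP/(_ jP)/implyP := Pin (tau (vtx R s j)).
by apply; exact: mem_t.
Qed.

End CellGeometry.

(** * The number of cells in a shell *)

Section ShellWeight.
Context {R : realType}.

Definition gdist n (X Y : 'I_(n.*2.+1) * 'I_(n.*2.+1)) : R :=
  ((X.1 : nat)%:R - (Y.1 : nat)%:R) ^+ 2 + ((X.2 : nat)%:R - (Y.2 : nat)%:R) ^+ 2.

Lemma gdistxx n X : @gdist n X X = 0.
Proof. by rewrite /gdist !subrr expr0n /= addr0. Qed.

Lemma gdist_ge0 n X Y : 0 <= @gdist n X Y.
Proof. by rewrite addr_ge0 ?sqr_ge0. Qed.

Lemma card_diam N (A : pred 'I_N) D :
  (forall i j : 'I_N, A i -> A j -> (i <= j)%N -> (j <= i + D)%N) -> (#|A| <= D.+1)%N.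
Proof.
move=> diam; case: (posnP #|A|) => [->//|/card_gt0P[i1 Ai1]].
have [i0 Ai0 min0] := @arg_minnP _ i1 A (fun i => i : nat) Ai1.
pose f (j : 'I_N) : 'I_D.+1 := inord (j - i0).
rewrite -(@card_in_image _ _ f A); last first.
  move=> i j Ai Aj; move/(congr1 val) => /=.
  have [hi hj] := (min0 _ Ai, min0 _ Aj).
  have [di dj] := (diam _ _ Ai0 Ai hi, diam _ _ Ai0 Aj hj).
  rewrite !inordK; try lia.
  by move=> e; apply/val_inj => /=; lia.
by rewrite -[X in (_ <= X)%N]card_ord max_card.
Qed.

(** For [i <= j] on the same side of [x], [(j - i) ^ 2] is at most the difference of the squares
    [(x - i) ^ 2] and [(x - j) ^ 2], hence at most [D ^ 2]. Each side thus holds at most [D.+1]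
    indices. *)
Lemma card_window N (x b : R) D :
  (#|[pred j : 'I_N | (`|(x - (j : nat)%:R) ^+ 2 - b| <= D%:R ^+ 2 / 2)%R]| <= 2 * D.+1)%N.
Proof.
set A := [pred j | _].
have half (B : pred 'I_N) : (forall i j : 'I_N, B i -> B j -> (i <= j)%N ->
    0 <= ((j : nat)%:R - x) * ((i : nat)%:R - x) :> R) -> (#|[predI A & B]| <= D.+1)%N.
  move=> Bs; apply: card_diam => i j /andP[Ai Bi] /andP[Aj Bj] ij.
  have := Bs i j Bi Bj ij; move: Ai Aj; rewrite /A !inE !ler_norml => /andP[h1 h2] /andP[h3 h4] h5.
  have ij' : (i : nat)%:R <= (j : nat)%:R :> R by rewrite ler_nat.
  rewrite -(ler_nat R) natrD -lerBlDl -ler_sqr ?nnegrE ?subr_ge0 //.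
  set u : R := i%:R in h1 h2 h5 ij' *; set v : R := j%:R in h3 h4 h5 ij' *.
  have vu : 0 <= v - u by rewrite subr_ge0.
  case: (lerP 0 (u - x)) => u0.
    have := mulr_ge0 u0 vu; nra.
  have v0 : 0 <= x - v.
    rewrite leNgt; apply/negP => v0; move: h5; rewrite leNgt => /negP; apply.
    by rewrite pmulr_rlt0 // -opprB oppr_gt0.
  have := mulr_ge0 v0 vu; nra.
rewrite -(cardID [pred j : 'I_N | x <= (j : nat)%:R] A) mul2n -addnn leq_add //.
  apply: half => i j /= xi xj _; apply: mulr_ge0; rewrite subr_ge0 //.
rewrite (@eq_card _ _ [predI A & [pred j : 'I_N | (j : nat)%:R < x]]).
  apply: half => i j /= xi xj _; apply: mulr_le0; rewrite subr_le0 ltW //.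
by move=> j; rewrite !inE /= -ltNge andbC.
Qed.

(** One window for each first index. With [n = 4 * r ^ 2] the half-width
    [2 * (16 * n) = 128 * r ^ 2] is exactly [(16 * r) ^ 2 / 2]. *)
Lemma card_shell r (X Y : 'I_((4 * r ^ 2).*2.+1) * 'I_((4 * r ^ 2).*2.+1)) :
  (#|shell (@gdist _) (16 * (4 * r ^ 2)%:R) X Y| <=
     (4 * r ^ 2).*2.+1 * (2 * (16 * r).+1))%N.
Proof.
pose S i j := shell (@gdist _) (16 * (4 * r ^ 2)%:R) X Y (i, j).
have -> : #|shell (@gdist _) (16 * (4 * r ^ 2)%:R) X Y| = (\sum_i \sum_(j | S i j) 1)%N.
  by rewrite -sum1_card pair_big_dep /=; apply: eq_bigl => -[].
rewrite -[X in (_ <= X * _)%N]card_ord -sum_nat_const; apply: leq_sum => i _.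
rewrite sum1_card.
apply: leq_trans (card_window ((4 * r ^ 2).*2.+1) (X.2 : nat)%:R (gdist X Y - ((X.1 : nat)%:R - (i : nat)%:R) ^+ 2) (16 * r)).
apply: subset_leq_card; apply/fintype.subsetP => j; rewrite !inE /S /shell.
rewrite {1}/gdist /=.
move=> h; rewrite opprB addrA [_ ^+ 2 + _ ^+ 2]addrC; apply: le_trans h _.
by rewrite !natrM; lra.
Qed.

End ShellWeight.

(** * The component event in terms of cell counts *)

Section Region.
Context {R : realType}.
Variables (M : R) (r : nat) (a1 a2 : R) (b1 b1' b2 b2' k : nat).
Hypotheses (M0 : 0 < M) (r0 : (0 < r)%N) (k0 : (0 < k)%N).

Let n := (4 * r ^ 2)%N.
Let T : finType := ('I_(n.*2.+1) * 'I_(n.*2.+1))%type.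
Let n0 : (0 < n)%N. Proof. by rewrite muln_gt0 expn_gt0 r0. Qed.
Let n0' : 0 < n%:R :> R. Proof. by rewrite ltr0n. Qed.
Let l := M * Num.sqrt (k%:R : R).
Let l0 : 0 < l. Proof. by rewrite mulr_gt0 // sqrtr_gt0 ltr0n. Qed.

(** The area of a cell divided by [k]. It is the same at all scales, so that [k] enters only as an
    intensity. *)
Definition cell_wt (c : T) : R := if odd c.1 && odd c.2 then M ^+ 2 / n%:R ^+ 2 else 0.

Definition box : set (pt R) :=
  [set x | a1 <= x <= a1 + M * Num.sqrt k%:R] `*` [set y | a2 <= y <= a2 + M * Num.sqrt k%:R].
(* The endpoints are quarters of the side, hence grid points when 4 divides n. *)
Definition subbox : set (pt R) :=
  [set x | a1 + M * Num.sqrt k%:R * b1%:R / 4 <= x <= a1 + M * Num.sqrt k%:R * b1'%:R / 4] `*`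
  [set y | a2 + M * Num.sqrt k%:R * b2%:R / 4 <= y <= a2 + M * Num.sqrt k%:R * b2'%:R / 4].
Definition comp_prob : R := PPprob R box (has_comp_inside R k subbox).

Definition in_cells : pred T := fun Z =>
  [&& ((r ^ 2 * b1).*2 <= Z.1)%N, (Z.1 <= (r ^ 2 * b1').*2)%N,
      ((r ^ 2 * b2).*2 <= Z.2)%N & (Z.2 <= (r ^ 2 * b2').*2)%N].

Definition cell_good (K : R) (c : {ffun T -> nat}) :=
  good (@gdist R n) (16 * n%:R) in_cells K c.

Lemma cell_wt_ge0 c : 0 <= cell_wt c.
Proof. by rewrite /cell_wt; case: ifP => // _; rewrite divr_ge0 ?sqr_ge0. Qed.

Let tau := cell2 (grid n a1 l) (grid n a2 l).
Let mA a := @grid_cell_measurable R n a l n0 l0.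
Let muA a := @grid_cell_measure R n a l n0 l0.

Lemma wt2_grid : wt2 (@grid_wt R n l) (@grid_wt R n l) = fun c => k%:R * cell_wt c.
Proof.
apply/funext => -[i j]; rewrite /wt2 /grid_wt /cell_wt /=.
case: (odd i); case: (odd j); rewrite ?mulr0 ?mul0r //=.
have -> : l / n%:R * (l / n%:R) = l ^+ 2 / n%:R ^+ 2 by field; rewrite gt_eqF.
by rewrite /l exprMn sqr_sqrtr // (mulrC (M ^+ 2)) mulrA.
Qed.

Lemma sum_grid_wt : \sum_i @grid_wt R n l i = l.
Proof.
have aux (w : R) m : \sum_(i < m.*2.+1) (if odd i then w else 0) = w *+ m.
  elim: m => [|m IH]; first by rewrite big_ord1 mulr0n.
  rewrite doubleS 2!big_ord_recr /= IH odd_double /= addr0.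
  by rewrite mulrSr.
by rewrite /grid_wt aux -[LHS]mulr_natr divfK // gt_eqF.
Qed.

Lemma sum_cell_wt : \sum_c k%:R * cell_wt c = k%:R * M ^+ 2.
Proof.
have -> : \sum_c k%:R * cell_wt c = \sum_i \sum_j @grid_wt R n l i * @grid_wt R n l j.
  rewrite pair_bigA; apply: eq_bigr => -[i j] _.
  exact: esym (congr1 (fun f => f (i, j)) wt2_grid).
under eq_bigr => i _ do rewrite -mulr_sumr sum_grid_wt.
by rewrite -mulr_suml sum_grid_wt -expr2 exprMn sqr_sqrtr // mulrC.
Qed.

(** About [2 * n] rows of about [32 * r] cells, each of weight at most [M ^+ 2 / n ^+ 2], give
    [16 * M ^+ 2 / r]; the constant 20 absorbs the rounding. *)
Lemma shell_wt (X Y : T) :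
  \sum_(Z | shell (@gdist R n) (16 * n%:R) X Y Z) k%:R * cell_wt Z <=
  20 * M ^+ 2 / r%:R * k%:R.
Proof.
have r0' : 1 <= r%:R :> R by rewrite ler1n.
have le_wt c : cell_wt c <= M ^+ 2 / n%:R ^+ 2.
  by rewrite /cell_wt; case: ifP => // _; rewrite divr_ge0 ?sqr_ge0.
rewrite -mulr_sumr mulrC ler_pM2r ?ltr0n //.
apply: le_trans (ler_sum _ (fun c _ => le_wt c)) _.
rewrite sumr_const -[X in X <= _]mulr_natr.
apply: (@le_trans _ _ (M ^+ 2 / n%:R ^+ 2 * (n.*2.+1 * (2 * (16 * r).+1))%:R)).
  by rewrite ler_wpM2l ?divr_ge0 ?sqr_ge0 // ler_nat card_shell.
have key : (n.*2.+1 * (2 * (16 * r).+1))%:R * r%:R <= 20 * n%:R ^+ 2 :> R.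
  rewrite /n -mul2n natrM -natr1 (natrM _ 2 (16 * r).+1) -[(16 * r).+1%:R]natr1 !natrM ?natrX.
  set x : R := r%:R in r0' *.
  have x0 : 0 <= x by rewrite (le_trans ler01).
  have x12 : x <= x ^+ 2 by rewrite expr2 ler_peMl.
  have x23 : x ^+ 2 <= x ^+ 3 by rewrite exprS ler_peMl ?sqr_ge0.
  rewrite -subr_ge0; set d := (X in 0 <= X).
  have -> : d = x * (64 * x ^+ 3 - 16 * x ^+ 2 - 32 * x - 2) by rewrite /d; ring.
  by apply: mulr_ge0 => //; lra.
have -> : 20 * M ^+ 2 / r%:R = M ^+ 2 / n%:R ^+ 2 * (20 * n%:R ^+ 2 / r%:R).
  by field; rewrite !gt_eqF // (lt_le_trans ltr01).
by rewrite ler_wpM2l ?divr_ge0 ?sqr_ge0 // ler_pdivlMr // (lt_le_trans ltr01).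
Qed.

(** After scaling, the squared distance is a sum of squared differences of doubled coordinates. On
    each axis the index difference is off by at most 2 and both differences are at most [2 * n] in
    size, so the squares differ by at most [2 * (4 * n)]. *)
Let dist_cell p p' : box p -> box p' ->
  `|4 * n%:R ^+ 2 / l ^+ 2 * d2 R p p' - gdist (tau p') (tau p)| <= 16 * n%:R.
Proof.
move=> [px py] [px' py'].
have aux a x x' : a <= x <= a + l -> a <= x' <= a + l ->
  `|4 * n%:R ^+ 2 / l ^+ 2 * (x - x') ^+ 2 -
    ((grid n a l x' : nat)%:R - (grid n a l x : nat)%:R) ^+ 2| <= 8 * n%:R.
  move=> hx hx'.
  have := @grid_coord R n a l l0 x hx; have := @grid_coord R n a l l0 x' hx'.
  have := @coord_itv R n a l l0 x hx; have := @coord_itv R n a l l0 x' hx'.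
  have -> : 4 * n%:R ^+ 2 / l ^+ 2 * (x - x') ^+ 2 =
    (2 * coord n a l x - 2 * coord n a l x') ^+ 2.
    by rewrite /coord; field; rewrite gt_eqF.
  have gn y : (grid n a l y : nat)%:R <= 2 * n%:R :> R.
    by rewrite -natrM ler_nat mul2n -ltnS.
  have := gn x; have := gn x'.
  have := ler0n R (grid n a l x); have := ler0n R (grid n a l x').
  set g := (nat_of_ord (grid n a l x))%:R; set g' := (nat_of_ord (grid n a l x'))%:R.
  set u := coord n a l x; set u' := coord n a l x'.
  move=> h1 h2 h3 h4 /andP[h5 h6] /andP[h7 h8].
  move=> /ler_normlP[h9 h10] /ler_normlP[h11 h12].
  have -> : (2 * u - 2 * u') ^+ 2 - (g' - g) ^+ 2 =
    (2 * u - 2 * u' - (g - g')) * (2 * u - 2 * u' + (g - g')) by ring.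
  rewrite normrM -[8 * _](_ : 2 * (4 * n%:R) = _); last by ring.
  by apply: ler_pM => //; rewrite ler_norml; apply/andP; split; lra.
rewrite /d2 /gdist mulrDr.
have -> : forall x y z t : R, x + y - (z + t) = (x - z) + (y - t) by move=> *; ring.
apply: le_trans (ler_normD _ _) _.
by have := aux _ _ _ px px'; have := aux _ _ _ py py'; rewrite /tau /=; lra.
Qed.

Let in_cellsP p : box p -> subbox p <-> in_cells (tau p).
Proof.
move=> [px py].
have qE (b : nat) : l * (r ^ 2 * b)%:R / n%:R = l * b%:R / 4.
  by rewrite /n !natrM ?natrX; field; rewrite pnatr_eq0 -lt0n.
rewrite /in_cells /tau /=.
rewrite !(grid_ge n0 l0) // !(grid_le n0 l0) //.
rewrite ![_ <= coord _ _ _ _]leNgt ![coord _ _ _ _ <= _]leNgt.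
rewrite !(coord_lt _ n0 l0) // !(coord_gt _ n0 l0) // !qE -!leNgt.
rewrite /subbox /= -/l; split.
  by move=> [/andP[-> ->] /andP[-> ->]].
by move=> /and4P[-> -> -> ->].
Qed.

Lemma comp_prob_ge (K : R) c : k.+1%:R <= K -> cell_good K c ->
  poisson_pmf (fun Z => k%:R * cell_wt Z) c <= comp_prob.
Proof.
move=> kK gc.
rewrite poisson_pmf_dint.
have := @PPprob_ge _ _ _ _ _ _ _ _ (mA a1) (muA a1) (mA a2) (muA a2)
  (has_comp_inside R k subbox) (fun t => content t == c) (\sum_i c i)%N.
rewrite wt2_grid; apply => s sQ /eqP sc.
have k4 : 0 < 4 * n%:R ^+ 2 / l ^+ 2 by rewrite divr_gt0 ?exprn_gt0 // mulr_gt0 // exprn_gt0.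
apply: (component_of_good k4 _ _ kK (tau := tau)).
- by move=> p p' /sQ hp /sQ hp'; exact: dist_cell.
- by move=> p /sQ hp; exact: in_cellsP.
- by rewrite sc.
Qed.

Lemma comp_prob_le1 : comp_prob <= 1.
Proof.
apply: (PPprob_le (mA a1) (muA a1) (mA a2) (muA a2) (g := fun t => (0 <= (count predT t)%:R :> R)%R%:R)) => //.
- by move=> s _ _; rewrite ler0n.
- move=> N; rewrite wt2_grid.
  apply: le_trans (chernoff predT 0 N _ (lexx 0)) _.
    by move=> c; rewrite mulr_ge0 // cell_wt_ge0.
  by rewrite expR0 subrr mulr0 mul0r subrr expR0.
Qed.

(** Union bound: either the counts are good, or some shell holds at least [b] points, or there are
    at least [C * k] points. Chernoff's bound treats the last two, with parameters [s] and 1. *)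
Lemma comp_prob_le (b C s : R) : b <= k%:R -> 0 <= C -> 0 <= s ->
  comp_prob <=
    \sum_(c : {ffun T -> 'I_(Num.truncn (C * k%:R)).+1} |
         cell_good (k%:R - b) [ffun i => c i : nat] && (\sum_i c i <= Num.truncn (C * k%:R))%N)
       poisson_pmf (fun Z => k%:R * cell_wt Z) [ffun i => c i : nat] +
    (#|T| ^ 2)%:R * expR (20 * M ^+ 2 / r%:R * k%:R * (expR s - 1) - s * b) +
    expR (k%:R * M ^+ 2 * (expR 1 - 1) - C * k%:R).
Proof.
move=> bk C0 s0; set K := Num.truncn _.
pose w := fun Z => k%:R * cell_wt Z.
have w0 Z : 0 <= w Z by rewrite mulr_ge0 // cell_wt_ge0.
pose sh (XY : T * T) := shell (@gdist R n) (16 * n%:R) XY.1 XY.2.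
pose g1 t : R := ((size t <= K)%N && cell_good (k%:R - b) (content t))%:R.
pose g2 t : R := \sum_XY (b <= (count (sh XY) t)%:R :> R)%R%:R.
pose g3 (t : seq T) : R := (C * k%:R <= (count predT t)%:R :> R)%R%:R.
refine (@PPprob_le _ _ _ _ _ _ _ _ (mA a1) (muA a1) (mA a2) (muA a2)
  _ (fun t => g1 t + g2 t + g3 t) _ _ _ _).
- by move=> t; rewrite !addr_ge0 // sumr_ge0.
- move=> s' sQ E.
  have g1_0 t : 0 <= g1 t by [].
  have g2_0 t : 0 <= g2 t by rewrite sumr_ge0.
  have g3_0 t : 0 <= g3 t by [].
  rewrite -/tau; set t := map tau s'.
  case: (leqP (size t) K) => tK; last first.
    suff -> : g3 t = 1 by rewrite lerDr addr_ge0.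
    have -> // : g3 t = true%:R.
    congr (nat_of_bool _)%:R; rewrite count_predT.
    have /andP[_ h] := truncn_itv (mulr_ge0 C0 (ler0n R k)).
    by rewrite (le_trans (ltW h)) // ler_nat.
  case: (boolP [exists XY, b <= (count (sh XY) t)%:R]) => [/existsP[XY hXY]|/existsPn nsh].
    have : 1 <= g2 t.
      rewrite /g2 (bigD1 XY) //= hXY lerDl sumr_ge0 //.
    by have := g1_0 t; have := g3_0 t; lra.
  suff -> : g1 t = 1 by rewrite -addrA lerDl addr_ge0.
  have k4 : 0 < 4 * n%:R ^+ 2 / l ^+ 2 by rewrite divr_gt0 ?exprn_gt0 // mulr_gt0 // exprn_gt0.
  rewrite /g1 tK /=.
  have -> // : cell_good (k%:R - b) (content t) = true.
  apply: (good_of_component k4 (@gdistxx R n) (@gdist_ge0 R n) _ _ bk _ E).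
  + by move=> p p' /sQ hp /sQ hp'; exact: dist_cell.
  + by move=> p /sQ hp; exact: in_cellsP.
  + by move=> X Y; rewrite ltNge; exact: (nsh (X, Y)).
move=> N; rewrite wt2_grid -/w.
under eq_bigr => m _.
  have -> : dint w m (fun t => g1 t + g2 t + g3 t) = dint w m g1 + dint w m g2 + dint w m g3.
    have add (g h : seq T -> R) : dint w m (fun t => g t + h t) = dint w m g + dint w m h.
      elim: m g h => [//|m IH] g h /=.
      by rewrite -big_split /=; apply: eq_bigr => i _; rewrite IH mulrDr.
    by rewrite !add.
  rewrite 2!mulrDr; over.
rewrite !big_split /=; apply: lerD; first apply: lerD.
- exact: (sum_good_le _ _ _ w0).
- under eq_bigr => m _ do rewrite /g2 dint_sum mulr_sumr.
  rewrite exchange_big /=.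
  have step XY : \sum_(0 <= m < N) expR (- \sum_i w i) / m`!%:R *
      dint w m (fun t => (b <= (count (sh XY) t)%:R)%R%:R) <=
      expR (20 * M ^+ 2 / r%:R * k%:R * (expR s - 1) - s * b).
    apply: le_trans (chernoff (sh XY) b N w0 s0) _.
    rewrite ler_expR lerD2r ler_wpM2r ?shell_wt // subr_ge0.
    by rewrite -expR0 ler_expR.
  apply: le_trans (ler_sum _ (fun XY _ => step XY)) _.
  by rewrite sumr_const -[X in X <= _]mulr_natl card_prod expnS expn1.
- apply: le_trans (chernoff predT (C * k%:R) N w0 ler01) _.
  by rewrite sum_cell_wt mul1r.
Qed.

(** A lone point is a component. On the 4 by 4 grid the cell [Z0] at the lower corner of the subbox
    has mean [k * M ^+ 2 / 16], at least 1, so one point there and none elsewhere already has the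
    stated probability. *)
Lemma comp_prob_ge_exp : (b1 < b1' <= 4)%N -> (b2 < b2' <= 4)%N -> r = 1%N ->
  16 <= k%:R * M ^+ 2 -> expR (- (k%:R * M ^+ 2)) <= comp_prob.
Proof.
move=> /andP[hb1 hb1'] /andP[hb2 hb2'] r1 big.
have nE : n = 4%N by rewrite /n r1.
have lt1 : (b1.*2.+1 < n.*2.+1)%N by rewrite nE; lia.
have lt2 : (b2.*2.+1 < n.*2.+1)%N by rewrite nE; lia.
pose Z0 : T := (Ordinal lt1, Ordinal lt2).
pose c : {ffun T -> nat} := [ffun Z => (Z == Z0) : nat].
have cg : cell_good k.+1%:R c.
  apply/existsP; exists [set Z0]%SET; apply/and3P; split.
  - by apply/existsP; exists Z0; rewrite !inE ffunE eqxx.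
  - apply/forallP => Z; rewrite inE; apply/implyP => /eqP ->; apply/implyP => _.
    by rewrite /in_cells r1 /=; lia.
  - apply/forallP => Z; apply/implyP => _; apply/forallP => Y; rewrite !inE.
    by apply/implyP => /negbTE YZ; rewrite [c Y]ffunE YZ andbF.
apply: le_trans (comp_prob_ge (lexx _) cg).
rewrite /poisson_pmf sum_cell_wt -[leLHS]mulr1 ler_wpM2l ?expR_ge0 //.
rewrite (bigD1 Z0) //= big1 => [|Z /negbTE ZZ]; last by rewrite ffunE ZZ expr0 divr1.
rewrite mulr1 ffunE eqxx expr1 divr1 /cell_wt /= !odd_double /= nE mulrA.
by rewrite ler_pdivlMr ?exprn_gt0 // mul1r (le_trans _ big) // -natrX ler_nat.
Qed.

End Region.

(** * Convergence of the rate *)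

Section EventuallyAlmostMinimal.
Context {R : realType}.

(** The limit is the lower limit, taken as the supremum of the eventual lower bounds. Some large [k]
    has [f k] barely above it, and the second hypothesis then controls all later values. *)
Lemma cvg_eventually_almost_minimal (f : nat -> R) (B : R) :
  (forall k, (0 < k)%N -> 0 <= f k <= B) ->
  (forall eps : R, 0 < eps -> exists K0 : nat, forall k, (K0 <= k)%N ->
     exists K1 : nat, forall k', (K1 <= k')%N -> f k' <= f k + eps) ->
  exists c : R, f @ \oo --> c.
Proof.
move=> fB step.
pose A : set R := [set x | exists K : nat, forall k, (K <= k)%N -> x <= f k].
have A0 : A 0 by exists 1%N => k /fB/andP[].
have ubA : ubound A B.
  move=> x [K hK]; apply: le_trans (hK (maxn K 1) _) _; first exact: leq_maxl.
  have /fB/andP[_] : (0 < maxn K 1)%N by rewrite leq_max orbT.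
  by [].
have hsA : has_sup A by split; [exists 0 | exists B].
exists (sup A); apply/cvgrPdist_le => eps eps0.
have [e [K hK] he] := sup_adherent eps0 hsA.
have eps2 : 0 < eps / 2 by rewrite divr_gt0.
have [K0 hK0] := step _ eps2.
have [k Kk fk] : exists2 k, (K0 <= k)%N & f k < sup A + eps / 2.
  apply: contrapT => nex; have : A (sup A + eps / 2).
    exists K0 => k Kk; rewrite leNgt; apply/negP => lt; apply: nex; by exists k.
  by move/(sup_upper_bound hsA); lra.
have [K1 hK1] := hK0 _ Kk.
exists (maxn K K1) => // j /=; rewrite geq_max => /andP[Kj K1j].
by have := hK _ Kj; have := hK1 _ K1j; rewrite ler_norml => h1 h2; apply/andP; split; lra.
Qed.

Lemma cvg_min (f g : nat -> R) (a b : R) : f @ \oo --> a -> g @ \oo --> b ->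
  (fun k => Num.min (f k) (g k)) @ \oo --> Num.min a b.
Proof.
move=> /cvgrPdist_le fa /cvgrPdist_le gb; apply/cvgrPdist_le => eps eps0.
near=> k.
have /ler_normlP[h1 h2] : `|a - f k| <= eps by near: k; exact: fa.
have /ler_normlP[h3 h4] : `|b - g k| <= eps by near: k; exact: gb.
rewrite ler_norml; apply/andP.
by case: (leP a b) => hab; case: (leP (f k) (g k)) => hfg; split; lra.
Unshelve. all: by end_near. Qed.

(** From [ln (d * z) <= d * z - 1]. A small [d] makes the logarithm of the number of count vectors
    negligible against [k]. *)
Lemma ln_le_linear (d z : R) : 0 < d -> 0 < z -> ln z <= d * z - ln d.
Proof.
move=> d0 z0; have dz : 0 < d * z by exact: mulr_gt0.
have : -1 < d * z - 1 by lra.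
by move/le_ln1Dx; rewrite addrC subrK lnM ?posrE //; lra.
Qed.

(** The logarithmic form of the bound of [prob_repeat], with [rho = m * k / k']. *)
Lemma repeat_lnN (P P' rho N : R) (K tau m : nat) :
  0 < P -> 0 < P' -> 0 < rho -> 0 < N ->
  (rho^-1 ^+ K * (P / 2 / N ^+ tau)) ^+ m <= P' ->
  - ln P' <= m%:R * (K%:R * ln rho + - ln P + (ln 2 + tau%:R * ln N)).
Proof.
move=> P0 P'0 rho0 N0.
have P2 : 0 < P / 2 by rewrite divr_gt0.
have Nt : 0 < N ^+ tau by exact: exprn_gt0.
have q0 : 0 < P / 2 / N ^+ tau by exact: divr_gt0.
have V0 : 0 < rho^-1 by rewrite invr_gt0.
have rK0 : 0 < rho^-1 ^+ K by exact: exprn_gt0.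
have a0 : 0 < rho^-1 ^+ K * (P / 2 / N ^+ tau) by exact: mulr_gt0.
rewrite -ler_ln ?posrE //; last exact: exprn_gt0.
rewrite lnXn // lnM ?posrE // lnXn // lnV ?posrE // ln_div ?posrE // ln_div ?posrE // lnXn //.
rewrite -[X in X <= _]mulr_natl -[- ln rho *+ K]mulr_natl -[ln N *+ tau]mulr_natl.
by rewrite -lerN2 => /le_trans; apply; rewrite le_eqVlt; apply/orP; left; apply/eqP; ring.
Qed.

Lemma step_error_le (eta x B D : R) : 0 < eta <= 1 / 2 -> x <= B -> 0 < D ->
  (1 + 4 * eta) * (x + eta + 4 * D * eta) <= x + (4 * B + 3 * (1 + 4 * D)) * eta.
Proof.
move=> /andP[eta0 eta1] xB D0.
have h1 : 0 <= eta * (B - x) by rewrite mulr_ge0 ?subr_ge0 // ltW.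
have h2 : 0 <= (1 - 2 * eta) * (eta * (1 + 4 * D)) by apply: mulr_ge0; [lra | apply: mulr_ge0; lra].
by lra.
Qed.

End EventuallyAlmostMinimal.

(** * Comparison of the rates at two scales *)

Section Rate.
Context {R : realType}.
Variables (M : R) (a1 a2 : nat -> R) (b1 b1' b2 b2' : nat).
Hypotheses (M0 : 40 <= M) (hb1 : (b1 < b1' <= 4)%N) (hb2 : (b2 < b2' <= 4)%N).

Let p k : R := comp_prob M (a1 k) (a2 k) b1 b1' b2 b2' k.
Let f k : R := - ln (p k) / k%:R.
(** Chosen so that the exponent for an excess of points, [k * M ^+ 2 * (expR 1 - 1) - C * k], equals
    [- 2 * k * M ^+ 2]. *)
Let C : R := M ^+ 2 * (expR 1 + 1).
Let M0' : 0 < M. Proof. by apply: lt_le_trans M0. Qed.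
Let M2 : 1600 <= M ^+ 2. Proof. by have := M0; nra. Qed.

Let C0 : 0 < C.
Proof. by rewrite mulr_gt0 ?exprn_gt0 // addr_gt0 // expR_gt0. Qed.

Let p_ge k : (0 < k)%N -> expR (- (k%:R * M ^+ 2)) <= p k.
Proof.
move=> k0; apply: (comp_prob_ge_exp _ _ M0' (ltn0Sn 0) k0 hb1 hb2 erefl).
have : 1 <= k%:R :> R by rewrite ler1n.
by have := M2; nra.
Qed.

Let p_gt0 k : (0 < k)%N -> 0 < p k.
Proof. by move=> /p_ge; apply: lt_le_trans; exact: expR_gt0. Qed.

Let p_le1 k : (0 < k)%N -> p k <= 1.
Proof. by move=> k0; exact: (comp_prob_le1 _ _ _ _ _ _ M0' (ltn0Sn 0) k0). Qed.

Lemma rate_bounds k : (0 < k)%N -> 0 <= f k <= M ^+ 2.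
Proof.
move=> k0; have k0' : 0 < k%:R :> R by rewrite ltr0n.
apply/andP; split.
  by rewrite divr_ge0 // oppr_ge0 ln_le0 // p_le1.
rewrite ler_pdivrMr // lerNl -[leLHS]expRK ler_ln ?posrE ?expR_gt0 ?p_gt0 //.
by rewrite [M ^+ 2 * _]mulrC p_ge.
Qed.

(* A cell configuration typical for the event at scale k, repeated m times,
   realizes the event at scale k'. *)
Lemma prob_repeat (eta : R) : 0 < eta <= 1 / 2 ->
  exists tau K0 : nat, forall k, (K0 <= k)%N -> (0 < k)%N -> forall k' m : nat, (0 < k')%N ->
    k'.+1%:R <= m%:R * (k%:R - eta * k%:R) ->
    ((k'%:R / (m%:R * k%:R)) ^+ Num.truncn (C * k%:R) *
      (p k / 2 / (Num.truncn (C * k%:R)).+1%:R ^+ tau)) ^+ m <= p k'.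
Proof.
move=> /andP[eta0 eta1].
(* For [b = eta * k] the product [s * b] is [3 * k * M ^+ 2], and [r] is so large that the rest of
   the shell exponent is at most [k * M ^+ 2]. *)
pose s := 3 * M ^+ 2 / eta.
have s0 : 0 <= s by rewrite divr_ge0 ?mulr_ge0 ?sqr_ge0 // ltW.
pose r := (Num.truncn (20 * expR s)).+1.
have hr : 20 * (expR s - 1) <= r%:R.
  have h : 0 <= 20 * expR s by rewrite mulr_ge0 // expR_ge0.
  by have /andP[_ /ltW] := truncn_itv h; rewrite -/r; lra.
pose T : finType := ('I_((4 * r ^ 2).*2.+1) * 'I_((4 * r ^ 2).*2.+1))%type.
(* This threshold gives [2 * (#|T| ^ 2).+1 <= expR (k * M ^+ 2)], so all the error terms together
   take at most half of [p k]. *)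
exists #|T|, (2 * (#|T| ^ 2).+1)%N => k Kk k0 k' m k0' hm.
have kR : 0 < k%:R :> R by rewrite ltr0n.
have kR' : 0 < k'%:R :> R by rewrite ltr0n.
have rR : 0 < r%:R :> R by rewrite ltr0n.
have m0 : (0 < m)%N.
  by case: m hm => // ; rewrite mul0r leNgt ltr0n.
have bk : eta * k%:R <= k%:R by nra.
have /= ple := comp_prob_le (a1 k) (a2 k) b1 b1' b2 b2' M0' (ltn0Sn _ : (0 < r)%N) k0 bk (ltW C0) s0.
set E := expR (- (2 * (k%:R * M ^+ 2))).
have e1 : expR (20 * M ^+ 2 / r%:R * k%:R * (expR s - 1) - s * (eta * k%:R)) <= E.
  rewrite ler_expR.
  have -> : s * (eta * k%:R) = 3 * (k%:R * M ^+ 2) by rewrite /s; field; rewrite gt_eqF.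
  have -> : 20 * M ^+ 2 / r%:R * k%:R * (expR s - 1) = k%:R * M ^+ 2 * (20 * (expR s - 1) / r%:R).
    by field; rewrite gt_eqF.
  have : 20 * (expR s - 1) / r%:R <= 1 by rewrite ler_pdivrMr // mul1r.
  have : 0 <= k%:R * M ^+ 2 by rewrite mulr_ge0 ?sqr_ge0.
  by nra.
have e2 : expR (k%:R * M ^+ 2 * (expR 1 - 1) - C * k%:R) <= E.
  by rewrite ler_expR /C; lra.
have half : (#|T| ^ 2).+1%:R * E <= p k / 2.
  rewrite ler_pdivlMr //; apply: le_trans (p_ge k0).
  have -> : E = expR (- (k%:R * M ^+ 2)) * expR (- (k%:R * M ^+ 2)).
    by rewrite -expRD; congr expR; lra.
  rewrite mulrAC mulrA ler_piMl ?expR_ge0 // expRN ler_pdivrMr ?expR_gt0 // mul1r.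
  apply: le_trans (expR_ge1Dx _).
  rewrite -natrM mulnC; apply: (@le_trans _ _ k%:R); first by rewrite ler_nat.
  by have := M2; nra.
have pk2 : 0 < p k / 2 by rewrite divr_gt0 // p_gt0.
have Bsum : p k / 2 <= \sum_(c : {ffun T -> 'I_(Num.truncn (C * k%:R)).+1} |
         cell_good (r := r) b1 b1' b2 b2' (k%:R - eta * k%:R) [ffun i => c i : nat] &&
           (\sum_i c i <= Num.truncn (C * k%:R))%N)
       poisson_pmf (fun Z => k%:R * cell_wt M (r := r) Z) [ffun i => c i : nat].
  move: ple; rewrite -/(p k); set S := (X in _ <= X + _ + _ -> _) => ple.
  have : (#|T| ^ 2)%:R * expR (20 * M ^+ 2 / r%:R * k%:R * (expR s - 1) - s * (eta * k%:R))
     <= (#|T| ^ 2)%:R * E by rewrite ler_wpM2l.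
  by move: half; rewrite -natr1 mulrDl mul1r; rewrite /S in ple *; move: e2 ple; lra.
have w0 Z : 0 <= k%:R * cell_wt M (r := r) Z by rewrite mulr_ge0 // cell_wt_ge0.
have [c [gc cK cB]] := exists_ge_average (good := cell_good (r := r) b1 b1' b2 b2' (k%:R - eta * k%:R)) w0 pk2 Bsum.
have mk : k'%:R <= m%:R * k%:R :> R.
  apply: le_trans (le_trans _ hm) _; first by rewrite ler_nat.
  by rewrite ler_wpM2l // lerBlDr lerDl mulr_ge0 // ltW.
have := comp_prob_ge (a1 k') (a2 k') M0' (ltn0Sn _ : (0 < r)%N) k0' hm (good_scale m0 gc).
apply: le_trans.
apply: le_trans (poisson_pmf_scale c (cell_wt_ge0 M (r := r)) kR kR' m0 mk).
have mkR : 0 < m%:R * k%:R :> R by rewrite mulr_gt0 // ltr0n.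
have rho0 : 0 <= k'%:R / (m%:R * k%:R) :> R by rewrite divr_ge0 // ltW.
have rho1 : k'%:R / (m%:R * k%:R) <= 1 :> R by rewrite ler_pdivrMr // mul1r.
have q0 : 0 <= p k / 2 / (Num.truncn (C * k%:R)).+1%:R ^+ #|T|.
  by rewrite divr_ge0 ?exprn_ge0 // ltW.
have pm0 : 0 <= poisson_pmf (fun Z => k%:R * cell_wt M (r := r) Z) c.
  exact: poisson_pmf_ge0.
apply: lerXn2r; rewrite ?nnegrE.
- by apply: mulr_ge0 => //; exact: exprn_ge0.
- by apply: mulr_ge0 => //; exact: exprn_ge0.
apply: ler_pM => //.
(* The ratio is at most 1, so the exponent [\sum_i c i] may be raised to its upper bound. *)
by rewrite ler_wiXn2l.
Qed.

(** Logarithms are taken in [prob_repeat] with [m] about [k' / ((1 - eta) * k)]; the rounding, the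
    intensity ratio and the number of count vectors each cost a multiple of [eta]. *)
Lemma rate_step (eta : R) : 0 < eta <= 1 / 2 ->
  exists K0 : nat, forall k, (K0 <= k)%N -> exists K1 : nat, forall k', (K1 <= k')%N ->
    f k' <= f k + (4 * M ^+ 2 + 3 * (1 + 4 * C)) * eta.
Proof.
move=> eta01; have /andP[eta0 eta1] := eta01.
have [tau [K0 hK0]] := prob_repeat eta01.
have tau0 : 0 < tau.+1%:R :> R by rewrite ltr0n.
(* This makes [tau * d * C * k] at most [eta * k / 2]; [D] collects the terms free of [k], and [K0']
   bounds it by the other half. The successor of [tau] keeps the denominator positive. *)
pose d : R := eta / (2 * tau.+1%:R * C).
have d0 : 0 < d by rewrite divr_gt0 // !mulr_gt0.
pose D : R := tau%:R * d - tau%:R * ln d + ln 2.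
pose K0' := (Num.truncn (2 * `|D| / eta)).+1.
exists (maxn K0 K0') => k; rewrite geq_max => /andP[K0k K0k'].
have k0 : (0 < k)%N by apply: leq_trans K0k'.
have kR : 0 < k%:R :> R by rewrite ltr0n.
set K := Num.truncn (C * k%:R).
have KC : K%:R <= C * k%:R.
  by have /andP[] := truncn_itv (mulr_ge0 (ltW C0) (ltW kR)).
have Dk : D <= eta * k%:R / 2.
  have h : 0 <= 2 * `|D| / eta by rewrite divr_ge0 ?mulr_ge0 // ltW.
  have /andP[_ h2] := truncn_itv h.
  have : 2 * `|D| / eta <= k%:R by apply: le_trans (ltW h2) _; rewrite ler_nat.
  by rewrite ler_pdivrMr //; have := ler_norm D; lra.
have K1R : 0 < K.+1%:R :> R by rewrite ltr0n.
have hlog : ln 2 + tau%:R * ln K.+1%:R <= eta * k%:R.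
  have h1 : tau%:R * ln K.+1%:R <= tau%:R * (d * K.+1%:R - ln d).
    by rewrite ler_wpM2l // ln_le_linear.
  have h2 : tau%:R * (d * K%:R) <= eta * k%:R / 2.
    apply: (@le_trans _ _ (tau.+1%:R * (d * (C * k%:R)))); last first.
      rewrite le_eqVlt; apply/orP; left; apply/eqP; rewrite /d; field.
      by rewrite !gt_eqF.
    apply: ler_pM => //; first by rewrite mulr_ge0 // ltW.
      by rewrite ler_nat.
    by rewrite ler_wpM2l // ltW.
  by move: h1 h2 Dk; rewrite /D -natr1 !mulrBr !mulrDr mulr1; lra.
pose g : R := k%:R - eta * k%:R.
have g0 : 0 < g by rewrite /g; nra.
exists (Num.truncn ((k%:R + 2) / eta)).+1 => k' Kk'.
have k0' : (0 < k')%N by apply: leq_trans Kk'.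
have kR' : 0 < k'%:R :> R by rewrite ltr0n.
have kk' : k%:R + 2 <= eta * k'%:R.
  have h : 0 <= (k%:R + 2) / eta by rewrite divr_ge0 // ltW.
  have /andP[_ h2] := truncn_itv h.
  have : (k%:R + 2) / eta <= k'%:R by apply: le_trans (ltW h2) _; rewrite ler_nat.
  by rewrite ler_pdivrMr // mulrC.
pose m := (Num.truncn (k'.+1%:R / g)).+1.
have [hm1 hm2] : k'.+1%:R <= m%:R * g /\ m%:R * g <= k'.+1%:R + g.
  have h : 0 <= k'.+1%:R / g by rewrite divr_ge0 // ltW.
  have /andP[h1 h2] := truncn_itv h.
  rewrite ler_pdivlMr // in h1; rewrite ltr_pdivrMr // in h2.
  split; first exact: ltW.
  by rewrite /m -natr1 mulrDl mul1r lerD2r.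
have mR : 0 < m%:R :> R by rewrite ltr0n.
have mk0 : 0 < m%:R * k%:R :> R by rewrite mulr_gt0.
pose rho : R := m%:R * k%:R / k'%:R.
have rho0 : 0 < rho by rewrite divr_gt0.
(* Rounding gives [(1 - eta) * rho <= 1 + eta], which is at most [(1 - eta) * (1 + 4 * eta)] because
   [eta <= 1 / 2]. *)
have rho_le : rho <= 1 + 4 * eta.
  have eta1' : 0 < 1 - eta by lra.
  rewrite ler_pdivrMr // -(ler_pM2l eta1').
  have -> : (1 - eta) * (m%:R * k%:R) = m%:R * g by rewrite /g; ring.
  apply: le_trans hm2 _; rewrite -natr1 /g.
  have : 0 <= eta * (1 - 2 * eta) * k'%:R.
    by rewrite !mulr_ge0 ?(ltW eta0) ?(ltW kR') //; lra.
  have : 0 <= eta * k%:R by rewrite mulr_ge0 // ltW.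
  by have := kk'; nra.
have lnrho : ln rho <= 4 * eta.
  have : -1 < rho - 1 by lra.
  by move/le_ln1Dx; rewrite addrC subrK; lra.
have pk := p_gt0 k0.
have := hK0 k K0k k0 k' m k0' hm1; rewrite -/K => hp.
have rhoV : k'%:R / (m%:R * k%:R) = rho^-1 by rewrite /rho invf_div.
rewrite rhoV in hp; have {}hp := repeat_lnN pk (p_gt0 k0') rho0 K1R hp.
have fkE : - ln (p k) = f k * k%:R by rewrite /f divfK // gt_eqF.
have KLn : K%:R * ln rho <= C * k%:R * (4 * eta).
  apply: (@le_trans _ _ (K%:R * (4 * eta))); first by rewrite ler_wpM2l.
  by rewrite ler_wpM2r // mulr_ge0 // ltW.
have main : - ln (p k') <= m%:R * (k%:R * (f k + eta + 4 * C * eta)).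
  by apply: le_trans hp _; rewrite ler_wpM2l ?(ltW mR) // fkE; lra.
have /andP[fk0 fkM] := rate_bounds k0.
have b0 : 0 <= f k + eta + 4 * C * eta.
  by rewrite !addr_ge0 ?(ltW eta0) // !mulr_ge0 // ltW.
apply: (@le_trans _ _ (rho * (f k + eta + 4 * C * eta))).
  rewrite {1}/f ler_pdivrMr //; apply: le_trans main _.
  by rewrite /rho le_eqVlt; apply/orP; left; apply/eqP; field; rewrite gt_eqF.
apply: (@le_trans _ _ ((1 + 4 * eta) * (f k + eta + 4 * C * eta))).
  by rewrite ler_wpM2r.
exact: step_error_le.
Qed.

Lemma rate_cvg : exists c : R, f @ \oo --> c.
Proof.
apply: (@cvg_eventually_almost_minimal _ f (M ^+ 2)); first exact: rate_bounds.
move=> eps eps0; pose L := 4 * M ^+ 2 + 3 * (1 + 4 * C).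
have L0 : 0 < L by have := M2; have := C0; rewrite /L; lra.
pose eta := Num.min (eps / L) (1 / 2).
have eta01 : 0 < eta <= 1 / 2.
  by rewrite lt_min !divr_gt0 //= ge_min lexx orbT.
have [K0 hK0] := rate_step eta01; exists K0 => k /hK0[K1 hK1]; exists K1 => k' /hK1.
move=> /le_trans; apply; rewrite lerD2l -/L mulrC -ler_pdivlMr //.
by rewrite ge_min lexx.
Qed.

End Rate.

(** * The two regions as boxes with quartered sides *)

Section Regions.
Context {R : realType}.
Implicit Types (M : R) (k : nat).

Lemma Ssq_box M k : Ssq R M k = box M (- hs R M k) (- hs R M k) k.
Proof.
apply/seteqP; split => -[x y]; rewrite /Ssq /box /= /hs !ler_norml.
  by move=> [/andP[h1 h2] /andP[h3 h4]]; split; apply/andP; split; lra.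
by move=> [/andP[h1 h2] /andP[h3 h4]]; split; apply/andP; split; lra.
Qed.

Lemma Ssq'_subbox M k : Ssq' R M k = subbox M (- hs R M k) (- hs R M k) 1 3 1 3 k.
Proof.
apply/seteqP; split => -[x y]; rewrite /Ssq' /subbox /= /hs !ler_norml.
  by move=> [/andP[h1 h2] /andP[h3 h4]]; split; apply/andP; split; lra.
by move=> [/andP[h1 h2] /andP[h3 h4]]; split; apply/andP; split; lra.
Qed.

Lemma Rrect_box M k : Rrect R M k = box M 0 (- hs R M k) k.
Proof.
apply/seteqP; split => -[x y]; rewrite /Rrect /box /= /hs !ler_norml.
  by move=> [/andP[h1 h2] /andP[h3 h4]]; split; apply/andP; split; lra.
by move=> [/andP[h1 h2] /andP[h3 h4]]; split; apply/andP; split; lra.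
Qed.

Lemma Rrect'_subbox M k : Rrect' R M k = subbox M 0 (- hs R M k) 0 2 1 3 k.
Proof.
apply/seteqP; split => -[x y]; rewrite /Rrect' /subbox /= /hs !ler_norml.
  by move=> [/andP[h1 h2] /andP[h3 h4]]; split; apply/andP; split; lra.
by move=> [/andP[h1 h2] /andP[h3 h4]]; split; apply/andP; split; lra.
Qed.

End Regions.

Theorem theorem2 (R : realType) (M : R) (hM40 : 40 <= M) (hM : M_hyp R M) :
  (exists c1 : R, (fun k : nat => f1 R M k) @ \oo --> c1) /\
  (exists c2 : R, (fun k : nat => Num.min (f1 R M k) (f2 R M k)) @ \oo --> c2).
Proof.
have E1 : f1 R M = fun k => - ln (comp_prob M (- hs R M k) (- hs R M k) 1 3 1 3 k) / k%:R.
  by apply/funext => k; rewrite /comp_prob -Ssq_box -Ssq'_subbox.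
have E2 : f2 R M = fun k => - ln (comp_prob M 0 (- hs R M k) 0 2 1 3 k) / k%:R.
  by apply/funext => k; rewrite /comp_prob -Rrect_box -Rrect'_subbox.
(* The inner square spans quarters 1 to 3 in both directions for [f1]; for [f2] it spans quarters 0
   to 2 horizontally and 1 to 3 vertically. *)
have [c1 h1] := @rate_cvg R M (fun k => - hs R M k) (fun k => - hs R M k) 1 3 1 3 hM40 isT isT.
have [c2 h2] := @rate_cvg R M (fun=> 0) (fun k => - hs R M k) 0 2 1 3 hM40 isT isT.
rewrite E1 E2; split; first by exists c1.
by exists (Num.min c1 c2); exact: cvg_min.
Qed.
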